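(* Let $q\ge 2$ be a prime power and $N\ge 1$ an integer. Let $g:\mathcal{M}\to[0,\infty)$ be a non-negative multiplicative function satisfying $\log g(P^\ell)\ll \ell$ for every integer $\ell\ge 1$ and every monic irreducible $P$, and $g(F)\ll_\varepsilon 2^{\varepsilon\deg F}$ for every $\varepsilon>0$ and every $F\in\mathcal{M}$. If $A\in\mathcal{M}_N$, $0<\beta<1/2$, $h$ is an integer with $\beta N<h\le N-1$, and $N$ is sufficiently large depending only on $\beta$, then $$\sum_{F\in\mathcal{I}(A,h)}g(F)\ \ll_\beta\ \frac{q^{h+1}}{N}\exp\Big(\sum_{P\in\mathcal{P}_{\le N}}\frac{g(P)}{q^{\deg P}}\Big).$$
   Context: $\mathcal{M}$ is the set of monic polynomials in $\mathbb{F}_q[t]$, $\mathcal{M}_N$ the subset of those of degree $N$, and $\mathcal{P}_{\le N}$ the set of monic irreducible polynomials of degree $\le N$. For $A\in\mathcal{M}_N$, $\mathcal{I}(A,h):=\{F\in\mathcal{M}_N:\deg(F-A)\le h\}$ (the zero polynomial has degree $\le h$ for all $h$). Multiplicative means $g(1)=1$ and $g(FG)=g(F)g(G)$ for coprime $F,G$. The hypotheses mean: there is a constant $A_1>0$ with $g(P^\ell)\le A_1^\ell$ for all monic irreducible $P$ and all $\ell\ge1$, and for every $\varepsilon>0$ there is a constant $C_\varepsilon>0$ with $g(F)\le C_\varepsilon 2^{\varepsilon\deg F}$ for all $F\in\mathcal{M}$. The constant implied by $\ll_\beta$ depends only on $\beta$ and on the constants $A_1$, $(C_\varepsilon)_{\varepsilon>0}$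 implied in the hypotheses; it is uniform in $q,N,A,h$ and in all such $g$. *)

(* Defs.v *)
From HB Require Import structures.
From mathcomp Require Import all_boot all_order all_algebra all_field.
From mathcomp Require Import qpoly.
From mathcomp Require Import all_classical all_reals all_analysis.
Set Implicit Arguments.
Unset Strict Implicit.
Unset Printing Implicit Defensive.
Import Order.TTheory GRing.Theory Num.Theory.
Local Open Scope classical_set_scope.
Local Open Scope ring_scope.

(* Only used at nonzero polynomials; conditions [deg p <= n] that must also
   hold at p = 0 are written [size p <= n.+1]. *)
Definition degp (Fq : finFieldType) (p : {poly Fq}) : nat := (size p).-1.

Definition monic_of_deg (Fq : finFieldType) (N : nat) : set {poly Fq} :=
  [set F | F \is monic /\ degp F = N].
Arguments monic_of_deg : clear implicits.

Definition short_interval (Fq : finFieldType) (N : nat) (A : {poly Fq})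
    (h : nat) : set {poly Fq} :=
  [set F | monic_of_deg Fq N F /\ (size (F - A)%R <= h.+1)%N].

Definition monic_irreducible (Fq : finFieldType) : set {poly Fq} :=
  [set P | P \is monic /\ irreducible_poly P].
Arguments monic_irreducible : clear implicits.

Definition primes_upto (Fq : finFieldType) (N : nat) : set {poly Fq} :=
  [set P | monic_irreducible Fq P /\ (degp P <= N)%N].
Arguments primes_upto : clear implicits.

(* Arithmetic functions on monic polynomials are represented by functions on
   all polynomials, of which only the values at monic ones are ever used. *)
Definition multiplicative_on_monics (Fq : finFieldType) (R : realType)
    (g : {poly Fq} -> R) : Prop :=
  g 1 = 1 /\
  forall F G : {poly Fq}, F \is monic -> G \is monic -> coprimep F G ->
    g (F * G) = g F * g G.

(* The sums over [short_interval] and [primes_upto] are sums over finite sets,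
   so they never take the default value of [\sum_(_ \in _)]. *)
Lemma finite_poly_size (Fq : finFieldType) (n : nat) :
  finite_set [set p : {poly Fq} | (size p <= n)%N].
Proof.
have fin : finite_set ((fun p : {poly_n Fq} => p : {poly Fq}) @` [set: {poly_n Fq}]).
  by apply: finite_image; exact: finite_finset.
by apply: sub_finite_set fin => p sp; exists (NPoly sp).
Qed.

Lemma finite_short_interval (Fq : finFieldType) (N : nat) (A : {poly Fq})
  (h : nat) : finite_set (short_interval N A h).
Proof.
apply: sub_finite_set (finite_poly_size Fq N.+1) => F [[_]].
by rewrite /degp /= => <- _; case: (size F).
Qed.

Lemma finite_primes_upto (Fq : finFieldType) (N : nat) :
  finite_set (primes_upto Fq N).
Proof.
apply: sub_finite_set (finite_poly_size Fq N.+1) => F [_].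
by rewrite /degp /=; case: (size F).
Qed.

(* Main.v *)
(** Shiu's argument.  Put y = h/8, so that N <= M y for an integer M depending
    only on beta.  Multiplying the exact prime-power factors of F in order of
    increasing degree, one writes F = b d with b and d coprime, every prime
    factor of b of degree at most w, every prime factor of d of degree at least
    w, deg b <= 3 y, and either w > y or deg b >= 2 y, unless a prime of degree
    at most y divides F to such a power P^e that y < e deg P <= 2 y.  For fixed
    b the cofactors d fill a short interval and have no small prime factor, so
    Selberg's sieve counts them, with no error term since residues are exactly
    equidistributed in the interval; moreover g(d) is at most a^(N/w), as d has
    at most N/w prime factors.

    If w > y, the sieve saves 1/y and a^(N/y) is bounded.  If w is about 2^j,
    the sieve saves only 2^-j and a^(N/w) may be large, but b is
    2^(j+1)-smooth of degree at least 2 y, and Rankin's trick with exponent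
    theta proportional to 2^-j beats both.  When w is bounded, or F has a large
    prime-power divisor, there are so few F that g(F) << 2^(eps N) suffices. *)
Require Import Defs.
From HB Require Import structures.
From mathcomp Require Import all_boot all_order all_algebra all_field.
From mathcomp Require Import qpoly zify ring lra.
From mathcomp Require Import all_classical all_reals all_analysis.
Set Implicit Arguments.
Unset Strict Implicit.
Unset Printing Implicit Defensive.
Import Order.TTheory GRing.Theory Num.Theory.
Local Open Scope classical_set_scope.
Local Open Scope ring_scope.

(** * Comparison of finite sums along maps of index sets *)

Section FiniteSums.
Variable R : realType.

Lemma sum_cond1_le (I : eqType) (s : seq I) (i : I) (c : R) :
  uniq s -> 0 <= c -> \sum_(j <- s | i == j) c <= c.
Proof.
move=> us c0; have [si|nsi] := boolP (i \in s).
  rewrite big_mkcond (bigD1_seq i) //= eqxx big1 ?addr0 // => j.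
  by rewrite eq_sym => /negbTE ->.
rewrite big1_seq // => j /andP[/eqP <- sj]; by rewrite sj in nsi.
Qed.

Lemma ler_sum_term (J : eqType) (t : seq J) (Q : pred J) (F : J -> R) (j : J) :
  (forall j, Q j -> 0 <= F j) -> j \in t -> Q j ->
  F j <= \sum_(k <- t | Q k) F k.
Proof.
move=> F0 tj Qj; rewrite (big_rem j tj) /= Qj lerDl.
by apply: sumr_ge0.
Qed.

(** Stands in for exact reindexing: one preimage [j] per [i] suffices and [h] need not be injective,
    because surplus terms [F j] are nonnegative. *)
Lemma sum_cover (I J : eqType) (s : seq I) (t : seq J) (P : pred I)
    (Q : pred J) (f : I -> R) (F : J -> R) (h : J -> I) :
  uniq s -> (forall j, Q j -> 0 <= F j) ->
  (forall i, i \in s -> P i ->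
     exists j, [/\ j \in t, Q j, h j = i & f i <= F j]) ->
  \sum_(i <- s | P i) f i <= \sum_(j <- t | Q j) F j.
Proof.
move=> us F0 cov.
have step1 : \sum_(i <- s | P i) f i <=
    \sum_(i <- s | P i) \sum_(j <- t | Q j && (h j == i)) F j.
  rewrite big_seq_cond [leRHS]big_seq_cond; apply: ler_sum => i /andP[si Pi].
  have [j [tj Qj hj fF]] := cov i si Pi.
  apply: le_trans fF _; apply: ler_sum_term => //.
    by move=> k /andP[Qk _]; exact: F0.
  by rewrite Qj hj eqxx.
apply: le_trans step1 _.
rewrite (exchange_big_dep Q) /=; last by move=> i j _ /andP[].
apply: ler_sum => j Qj.
rewrite (eq_bigl (fun i => (h j == i) && P i)); last by move=> i; rewrite Qj andbC.
apply: le_trans (sum_cond1_le (h j) us (F0 j Qj)).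
rewrite big_mkcondr /=; apply: ler_sum => i _; case: ifP => // _.
exact: F0.
Qed.

Lemma sum_predW (I : Type) (s : seq I) (P Q : pred I) (f : I -> R) :
  (forall i, Q i -> 0 <= f i) -> (forall i, P i -> Q i) ->
  \sum_(i <- s | P i) f i <= \sum_(i <- s | Q i) f i.
Proof.
move=> f0 PQ; rewrite big_mkcond [leRHS]big_mkcond; apply: ler_sum => i _.
have := PQ i; case: (P i) => [/(_ isT) -> //|_]; case: ifP => //; exact: f0.
Qed.

End FiniteSums.

(** * Polynomials of bounded degree and equidistribution of residues *)

Section Polys.
Variable F : finFieldType.
Implicit Types (A B D P : {poly F}) (n k : nat).

(** Zero is included and degrees stay below [n]; for [h] less than the degree of a monic [A], the
    interval of radius [h] about [A] consists of the [A + B] with [B] in [polys h.+1]. *)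
Definition polys n : seq {poly F} := [seq val p | p <- enum {poly_n F}].

Lemma polys_uniq n : uniq (polys n).
Proof. by rewrite map_inj_uniq ?enum_uniq //; exact: val_inj. Qed.

Lemma mem_polys n p : (p \in polys n) = (size p <= n)%N.
Proof.
apply/mapP/idP => [[q _ ->]|sp]; first exact: size_npoly.
by exists (NPoly sp); rewrite ?mem_enum.
Qed.

Lemma size_polys n : size (polys n) = (#|F| ^ n)%N.
Proof. by rewrite size_map -cardE card_npoly. Qed.

Lemma monic_size A : A \is monic -> size A = (degp A).+1.
Proof. by move=> mA; rewrite /degp prednK // lt0n size_poly_eq0 monic_neq0. Qed.

Lemma degpM A B : A \is monic -> B \is monic -> degp (A * B) = (degp A + degp B)%N.
Proof.
move=> mA mB; rewrite /degp size_monicM ?monic_neq0 //.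
by rewrite (monic_size mA) (monic_size mB) /= addnS.
Qed.

Lemma degp1 : degp (1 : {poly F}) = 0%N.
Proof. by rewrite /degp size_poly1. Qed.

Lemma degpX A l : A \is monic -> degp (A ^+ l) = (l * degp A)%N.
Proof.
move=> mA; elim: l => [|l IH]; first by rewrite expr0 degp1.
by rewrite exprS degpM ?monic_exp // IH mulSn.
Qed.

Lemma card_field_gt1 : (1 < #|F|)%N.
Proof. exact: finNzRing_gt1. Qed.

(** Equidistribution is exact: as [A %% D] has size at most [degp D <= k], the solutions are
    precisely [B = D * C - A %% D] with [size C <= k - degp D]. *)
Lemma count_multiples A D k : D \is monic -> (degp D <= k)%N ->
  count (fun B => D %| A + B) (polys k) = (#|F| ^ (k - degp D))%N.
Proof.
move=> mD dk; have D0 := monic_neq0 mD; have sD := monic_size mD.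
have szDM C : C != 0 -> size (D * C) = (degp D + size C)%N.
  by move=> C0; rewrite size_mul // sD.
pose f C := D * C - A %% D.
have inj_f : injective f by move=> C C' /addIr /(mulfI D0).
rewrite -size_polys -(size_map f) -size_filter.
apply/perm_size/uniq_perm.
- exact/filter_uniq/polys_uniq.
- by rewrite map_inj_uniq ?polys_uniq.
have sr : (size (A %% D)%R <= k)%N.
  by rewrite (leq_trans _ dk) // -ltnS -sD ltn_modp.
move=> B; rewrite mem_filter mem_polys; apply/andP/mapP => [[dvB sB]|[C]].
  exists ((A + B) %/ D - A %/ D); last first.
    have e1 := divpK dvB; have e2 := divp_eq A D.
    rewrite /f mulrBr [D * (_ %/ _)]mulrC e1 [D * _]mulrC.
    by rewrite -addrA -opprD -e2 addrC addKr.
  have e : D * ((A + B) %/ D - A %/ D) = B + A %% D.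
    rewrite mulrBr [D * (_ %/ _)]mulrC (divpK dvB) [D * _]mulrC.
    by rewrite {1}(divp_eq A D); ring.
  rewrite mem_polys; set C := _ - _ in e *.
  have [->|C0] := eqVneq C 0; first by rewrite size_poly0.
  rewrite leq_subRL // -szDM // e.
  by rewrite (leq_trans (size_polyD _ _)) // geq_max sB sr.
rewrite mem_polys => sC ->; split.
  have -> : A + f C = D * C + A %/ D * D.
    by rewrite /f {1}(divp_eq A D); ring.
  by rewrite dvdp_add ?dvdp_mulIl ?dvdp_mulIr.
rewrite (leq_trans (size_polyD _ _)) // geq_max size_polyN sr andbT.
have [->|C0] := eqVneq C 0; first by rewrite mulr0 size_poly0.
by rewrite szDM // -leq_subRL.
Qed.

End Polys.

(** * Monic irreducible polynomials *)

Lemma sum_cover2 (R : realType) (I J K : eqType) (s : seq I) (t1 : seq J)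
    (t2 : J -> seq K) (P : pred I) (Q1 : pred J) (Q2 : J -> pred K)
    (f : I -> R) (G : J -> K -> R) (h : J -> K -> I) :
  uniq s -> (forall j k, Q1 j -> Q2 j k -> 0 <= G j k) ->
  (forall i, i \in s -> P i -> exists j k,
     [/\ j \in t1, k \in t2 j, Q1 j && Q2 j k, h j k = i & f i <= G j k]) ->
  \sum_(i <- s | P i) f i <=
    \sum_(j <- t1 | Q1 j) \sum_(k <- t2 j | Q2 j k) G j k.
Proof.
move=> us G0 cov.
apply: (@le_trans _ _ (\sum_(p <- [seq (j, k) | j <- t1, k <- t2 j] |
    Q1 p.1 && Q2 p.1 p.2) G p.1 p.2)).
  apply: (sum_cover (h := fun p => h p.1 p.2)) => // [p /andP[]|i si Pi].
    exact: G0.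
  have [j [k [tj tk Q hjk fG]]] := cov i si Pi.
  by exists (j, k); split=> //; apply: allpairs_f_dep.
rewrite big_mkcond big_allpairs_dep [leRHS]big_mkcond /=; apply: ler_sum => j _.
case: (Q1 j) => /=; first by rewrite [leRHS]big_mkcond.
by rewrite big1.
Qed.

Section Primes.
Variable F : finFieldType.
Implicit Types (A B D P Q m : {poly F}) (n k : nat).
Local Notation mi := (monic_irreducible F).

Lemma mi_monic P : mi P -> P \is monic. Proof. by case. Qed.

Lemma mi_degp P : mi P -> (0 < degp P)%N.
Proof. by move=> [mP [sP _]]; rewrite /degp -ltnS prednK // (ltn_trans _ sP). Qed.

Lemma mi_coprime P m : mi P -> coprimep P m = ~~ (P %| m).
Proof.
move=> [mP iP]; apply/idP/idP => [cPm|nPm].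
  apply/negP => dPm; case: iP => sP _.
  have := coprimep_dvdl dPm cPm; rewrite coprimepp => /eqP e.
  by rewrite e in sP.
apply/coprimepP => d dP dm; rewrite -size_poly_eq1.
apply/negPn/negP => sd; case: iP => _ /(_ d sd dP) edP.
by move: nPm; rewrite -(eqp_dvdl m edP) dm.
Qed.

Lemma mi_coprime_neq P Q : mi P -> mi Q -> P != Q -> coprimep P Q.
Proof.
move=> iP iQ; rewrite mi_coprime //; apply: contra => dPQ.
case: (iQ) => mQ [_ /(_ P)] H.
have sP : size P != 1 by case: iP => _ [sP _]; rewrite neq_ltn sP orbT.
by rewrite -eqp_monic ?(mi_monic iP) //; apply: H.
Qed.

Lemma mi_dvdM P A B : mi P -> P %| A * B -> (P %| A) || (P %| B).
Proof.
move=> iP; have [//|nPA] := boolP (P %| A).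
by rewrite Gauss_dvdpr // mi_coprime.
Qed.

Lemma mi_dvdX P A l : mi P -> P %| A ^+ l -> P %| A.
Proof.
move=> iP; elim: l => [|l IH]; last first.
  by rewrite exprS => /(mi_dvdM iP) /orP[|/IH].
by have := mi_coprime 1 iP; rewrite expr0 coprimep1 => /esym/negP.
Qed.

Lemma mi_dvd_mi P Q : mi P -> mi Q -> P %| Q -> P = Q.
Proof.
move=> iP iQ dPQ; apply/eqP/negPn/negP => /(mi_coprime_neq iP iQ).
by rewrite mi_coprime // dPQ.
Qed.

Lemma monic_dvd_degp A B : B \is monic -> A %| B -> (degp A <= degp B)%N.
Proof.
move=> mB dAB; have := dvdp_leq (monic_neq0 mB) dAB.
by rewrite /degp => H; rewrite -!subn1 leq_sub2r.
Qed.

Lemma monic_degp0 A : A \is monic -> degp A = 0%N -> A = 1.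
Proof.
move=> mA dA; have := monic_size mA; rewrite dA => /eqP sA.
case/size_poly1P: sA => c c0 e; move: mA; rewrite e monicE lead_coefC.
by move/eqP ->.
Qed.

Lemma monic_factor A B : A \is monic -> B \is monic -> A %| B ->
  exists2 C, C \is monic & B = A * C.
Proof.
move=> mA mB dAB; exists (B %/ A); last by rewrite mulrC divpK.
by rewrite -(monicMr _ mA) divpK.
Qed.

Lemma exists_prime_factor m : m \is monic -> m != 1 -> exists2 P, mi P & P %| m.
Proof.
have [n] := ubnP (degp m); elim: n m => // n IH m; rewrite ltnS => dm mm m1.
have sm : (1 < size m)%N.
  rewrite (monic_size mm) ltnS lt0n; apply: contraNneq m1 => d0.
  by rewrite (monic_degp0 mm).
have [im|nim] := pselect (irreducible_poly m); first by exists m.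
have [q [sq dq nq]] : exists q : {poly F}, [/\ size q != 1, q %| m & ~ (q %= m)].
  apply: contrapT => H; apply: nim; split=> // q sq dq.
  by apply: contrapT => nq; apply: H; exists q.
have q0 : q != 0 by apply: contraTneq dq => ->; rewrite dvd0p monic_neq0.
pose q' := (lead_coef q)^-1 *: q.
have lq : lead_coef q != 0 by rewrite lead_coef_eq0.
have mq' : q' \is monic by rewrite monicE lead_coefZ mulVf.
have eqq : q' %= q by rewrite eqp_scale // invr_eq0.
have dq' : q' %| m by rewrite (eqp_dvdl _ eqq).
have [|//||P iP dP] := IH q'.
- apply: leq_trans dm; rewrite ltn_neqAle monic_dvd_degp // andbT.
  apply: contra_notN nq => /eqP e.
  rewrite -(eqp_ltrans eqq) -dvdp_size_eqp //.
  by rewrite (monic_size mq') (monic_size mm) e.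
- by apply: contraNneq sq => e; rewrite -(eqp_size eqq) e size_poly1.
by exists P => //; exact: dvdp_trans dP dq'.
Qed.

Lemma prime_power_split P m : mi P -> m \is monic ->
  exists l m', [/\ m' \is monic, m = P ^+ l * m', ~~ (P %| m')
     & (P %| m -> (0 < l)%N)].
Proof.
move=> iP; have [n] := ubnP (degp m); elim: n m => // n IH m; rewrite ltnS => dm mm.
have [dPm|ndPm] := boolP (P %| m); last first.
  by exists 0%N, m; split=> //; rewrite expr0 mul1r.
have [C mC eC] := monic_factor (mi_monic iP) mm dPm.
have dC : (degp C < n)%N.
  apply: leq_trans dm; rewrite eC degpM ?(mi_monic iP) //.
  by rewrite -[X in (X < _)%N]add0n ltn_add2r mi_degp.
have [l [m' [mm' eC' nd _]]] := IH C dC mC.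
by exists l.+1; exists m'; split=> //; rewrite eC eC' exprS mulrA.
Qed.

Lemma prod_primes_dvd (ps : seq {poly F}) m : uniq ps ->
  {in ps, forall P, mi P} -> {in ps, forall P, P %| m} ->
  \prod_(P <- ps) P %| m.
Proof.
elim: ps => [|P ps IH] /=; first by rewrite big_nil dvd1p.
move=> /andP[nP us] ips dps; rewrite big_cons Gauss_dvdp.
  rewrite dps ?mem_head //= IH // => Q Qps; first by apply: ips; rewrite inE Qps orbT.
  by apply: dps; rewrite inE Qps orbT.
rewrite mi_coprime; last by apply: ips; rewrite mem_head.
apply/negP => dP; have iP : mi P by apply: ips; rewrite mem_head.
have ips' : {in ps, forall Q, mi Q} by move=> Q Qps; apply: ips; rewrite inE Qps orbT.
have {dP}: exists2 Q, Q \in ps & P %| Q.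
  elim: ps dP {us IH nP ips dps} ips' => [|Q ps IH].
    by have := mi_coprime 1 iP; rewrite coprimep1 big_nil => /esym/negP.
  rewrite big_cons => /(mi_dvdM iP)/orP[dQ _|/IH H ips']; first by exists Q; rewrite ?mem_head.
  have [|Q' ? ?] := H; first by move=> Q' Q'ps; apply: ips'; rewrite inE Q'ps orbT.
  by exists Q'; rewrite // inE; apply/orP; right.
by move=> [Q Qps /(mi_dvd_mi iP (ips' _ Qps)) e]; rewrite e Qps in nP.
Qed.

Lemma degp_prod (ps : seq {poly F}) : {in ps, forall P, P \is monic} ->
  degp (\prod_(P <- ps) P) = (\sum_(P <- ps) degp P)%N.
Proof.
elim: ps => [|P ps IH] mps; first by rewrite !big_nil degp1.
have mps' : {in ps, forall P, P \is monic}.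
  by move=> Q Qps; apply: mps; rewrite inE Qps orbT.
rewrite !big_cons degpM ?IH //; first by apply: mps; rewrite mem_head.
by rewrite big_seq; apply: rpred_prod => Q /mps'.
Qed.

Definition primes_le n : seq {poly F} := [seq P <- polys F n.+1 | `[< mi P >]].

Lemma mem_primes_le n P : (P \in primes_le n) = `[< mi P /\ (degp P <= n)%N >].
Proof.
rewrite mem_filter mem_polys; apply/andP/asboolP => [[/asboolP iP]|[iP]].
  by rewrite (monic_size (mi_monic iP)).
by split; [exact/asboolP|rewrite (monic_size (mi_monic iP))].
Qed.

Lemma primes_le_uniq n : uniq (primes_le n).
Proof. exact/filter_uniq/polys_uniq. Qed.

End Primes.

(** * Euler products *)

Section Sieve.
Variables (R : realType) (F : finFieldType).
Implicit Types (A B D P Q m : {poly F}) (n k : nat) (ps : seq {poly F}).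
Local Notation mi := (monic_irreducible F).

Definition pnorm P : R := #|F|%:R ^+ degp P.

Lemma cardF_gt1 : 1 < #|F|%:R :> R.
Proof. by rewrite ltr1n card_field_gt1. Qed.

Lemma cardF_gt0 : 0 < #|F|%:R :> R.
Proof. exact: lt_trans ltr01 cardF_gt1. Qed.

Lemma pnorm_gt0 P : 0 < pnorm P.
Proof. exact/exprn_gt0/cardF_gt0. Qed.

Lemma pnorm_gt1 P : mi P -> 1 < pnorm P.
Proof. by move=> /mi_degp dP; rewrite exprn_egt1 ?cardF_gt1 // -lt0n. Qed.

Lemma pnormM A B : A \is monic -> B \is monic -> pnorm (A * B) = pnorm A * pnorm B.
Proof. by move=> mA mB; rewrite /pnorm degpM // exprD. Qed.

Lemma pnormX A l : A \is monic -> pnorm (A ^+ l) = pnorm A ^+ l.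
Proof. by move=> mA; rewrite /pnorm degpX // mulnC exprM. Qed.

Lemma sum_multiples A D k : D \is monic -> (degp D <= k)%N ->
  \sum_(B <- polys F k | D %| A + B) 1 = #|F|%:R ^+ k / pnorm D.
Proof.
move=> mD dk; rewrite big_const_seq iter_addr_0 count_multiples // natrX.
by rewrite -[in RHS](subnK dk) exprD /pnorm mulfK // expf_neq0 // gt_eqF ?cardF_gt0.
Qed.

(** Divisibility by distinct primes gives exactly independent events of probability [1 / pnorm P]
    while the total degree is at most [k]. The modulus [D] collects the primes whose divisibility
    term was selected in the expansion, so that the induction on [ps] closes. *)
Lemma sum_multiples_prod (a b : {poly F} -> R) A k ps D : uniq ps ->
  {in ps, forall P, mi P} -> D \is monic ->
  {in ps, forall P, coprimep D P} ->
  (degp D + \sum_(P <- ps) degp P <= k)%N ->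
  \sum_(B <- polys F k | D %| A + B)
      \prod_(P <- ps) (a P + b P * (P %| A + B)%R%:R) =
  #|F|%:R ^+ k / pnorm D * \prod_(P <- ps) (a P + b P / pnorm P).
Proof.
elim: ps D => [|P ps IH] D.
  move=> _ _ mD _; rewrite !big_nil addn0 mulr1 => dk.
  by rewrite (eq_bigr (fun=> 1)) ?sum_multiples // => B _; rewrite big_nil.
move=> /= /andP[nP us] ips mD cD; rewrite !big_cons => dk.
have iP : mi P by apply: ips; rewrite mem_head.
have mP := mi_monic iP.
have ips' : {in ps, forall Q, mi Q} by move=> Q Qps; apply: ips; rewrite inE Qps orbT.
have cD' : {in ps, forall Q, coprimep D Q}.
  by move=> Q Qps; apply: cD; rewrite inE Qps orbT.
have cP : coprimep D P by apply: cD; rewrite mem_head.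
under eq_bigr => B _ do rewrite big_cons mulrDl.
rewrite big_split /= -mulr_sumr IH //; last by rewrite (leq_trans _ dk) // leq_add2l leq_addl.
have -> : \sum_(B <- polys F k | D %| A + B) (b P * (P %| A + B)%R%:R *
      \prod_(Q <- ps) (a Q + b Q * (Q %| A + B)%R%:R)) =
    b P * \sum_(B <- polys F k | D * P %| A + B)
      \prod_(Q <- ps) (a Q + b Q * (Q %| A + B)%R%:R).
  rewrite mulr_sumr big_mkcond [RHS]big_mkcond; apply: eq_bigr => B _ /=.
  rewrite Gauss_dvdp //; case: (D %| _) => //=.
  by case: (P %| _); rewrite /= ?mulr1 // mulr0 mul0r.
rewrite IH //.
- have h1 := lt0r_neq0 (pnorm_gt0 D); have h2 := lt0r_neq0 (pnorm_gt0 P).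
  by rewrite pnormM //; field; rewrite h1 h2.
- by rewrite monicMl.
- move=> Q Qps; rewrite coprimepMl cD' //=; apply: mi_coprime_neq => //; first exact: ips'.
  by apply: contraNneq nP => ->.
by rewrite degpM // -addnA.
Qed.

(* With [e = 1] the sum runs over the [m] whose set of prime factors is exactly
   [ps], with [e = 0] over those whose prime factors all lie in [ps]. *)
Lemma euler_product_le (f : {poly F} -> R) n (e : nat) ps :
  (e <= 1)%N -> f 1 = 1 -> (forall m, m \is monic -> 0 <= f m) ->
  (forall A B, A \is monic -> B \is monic -> coprimep A B -> f (A * B) = f A * f B) ->
  uniq ps -> {in ps, forall P, mi P} ->
  \sum_(m <- polys F n | [&& m \is monic,
       `[< forall P, mi P -> P %| m -> P \in ps >] &
       (e == 1) ==> all (fun P => P %| m) ps]) f m <=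
  \prod_(P <- ps) \sum_(l <- iota e n) f (P ^+ l).
Proof.
move=> e1 f1 f0 fM; elim: ps => [|P ps IH].
  move=> _ _; rewrite big_nil.
  apply: le_trans (_ : \sum_(m <- polys F n | 1 == m) 1 <= 1); last first.
    by apply: sum_cond1_le => //; exact: polys_uniq.
  rewrite big_mkcond [leRHS]big_mkcond; apply: ler_sum => m _.
  case: ifP; last by case: ifP.
  move=> /andP[mm /andP[/asboolP H _]]; rewrite (_ : m = 1) ?eqxx ?f1 //.
  apply/eqP/negPn/negP => m1; have [P iP dP] := exists_prime_factor mm m1.
  by have := H P iP dP.
move=> /= /andP[nP us] ips; rewrite big_cons.
have iP : mi P by apply: ips; rewrite mem_head.
have mP := mi_monic iP.
have ips' : {in ps, forall Q, mi Q} by move=> Q Qps; apply: ips; rewrite inE Qps orbT.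
apply: le_trans (ler_wpM2l _ (IH us ips')); last first.
  by apply: sumr_ge0 => l _; apply/f0/monic_exp.
rewrite mulr_suml; under [leRHS]eq_bigr do rewrite mulr_sumr.
apply: (sum_cover2 (h := fun l m' => P ^+ l * m')).
- exact: polys_uniq.
- by move=> l m _ /andP[mm _]; rewrite mulr_ge0 ?f0 ?monic_exp.
move=> m; rewrite mem_polys => sm /and3P[mm /asboolP suppm ePm].
have [l [m' [mm' em ndP lP]]] := prime_power_split iP mm.
have Pm'X : coprimep (P ^+ l) m' by rewrite coprimep_expl // mi_coprime.
exists l, m'; split.
(* Since [degp P >= 1], the exponent satisfies [l <= degp m < n]. It is at least [e], because for
   [e = 1] the prime [P] is required to divide [m]. *)
- rewrite mem_iota; have sm' : (l + degp m' < n)%N.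
    rewrite (leq_trans _ sm) // (monic_size mm) ltnS em degpM ?monic_exp // degpX //.
    by rewrite leq_add2r leq_pmulr // mi_degp.
  apply/andP; split; last by rewrite ltn_addl // (leq_ltn_trans (leq_addr _ _) sm').
  move: e1 ePm {IH}; case: (e) => [//|[|//]] _ /= /andP[dP _]; exact: lP.
- rewrite mem_polys (leq_trans _ sm) // (monic_size mm) (monic_size mm') ltnS.
  by rewrite em degpM ?monic_exp // leq_addl.
- rewrite mm' /=; apply/andP; split.
    apply/asboolP => Q iQ dQ.
    have := suppm Q iQ; rewrite em dvdp_mull // inE => /(_ isT)/orP[/eqP e'|//].
    by rewrite -e' dQ in ndP.
  apply/implyP => e1'; move: ePm; rewrite e1' /= => /andP[_ /allP H].
  apply/allP => Q Qps; have := H Q Qps; rewrite em => /(mi_dvdM (ips' Q Qps)) /orP[|//].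
  move/(mi_dvdX (ips' Q Qps))/(mi_dvd_mi (ips' Q Qps) iP) => e'.
  by rewrite -e' Qps in nP.
- by rewrite em.
by rewrite em fM ?monic_exp.
Qed.

Lemma sum_geom_le (x : R) (e n : nat) : 0 <= x -> x < 1 ->
  \sum_(l <- iota e n) x ^+ l <= x ^+ e / (1 - x).
Proof.
move=> x0 x1; rewrite ler_pdivlMr ?subr_gt0 //.
elim: n e => [|n IH] e; first by rewrite big_nil mul0r exprn_ge0.
rewrite /= big_cons mulrDl; have := IH e.+1; rewrite exprS; lra.
Qed.

End Sieve.

(** * Selberg's sieve in a short interval *)

Section SelbergSieve.
Variables (R : realType) (F : finFieldType).
Implicit Types (A B m : {poly F}) (n k : nat) (ps : seq {poly F}).
Local Notation mi := (monic_irreducible F).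
Local Notation nm := (@pnorm R F).

Definition rough n m := `[< forall P, mi P -> P %| m -> (n < degp P)%N >].

(** Each degree [j < n] contributes exactly 1, the monic polynomials of degree [j] being the
    ['X^j + B] with [B] in [polys F j]. *)
Lemma sum_monic_inv_pnorm n :
  \sum_(m <- polys F n | m \is monic) (nm m)^-1 = n%:R.
Proof.
apply/eqP; rewrite eq_le; apply/andP; split.
  apply: (@le_trans _ _ (\sum_(j <- iota 0 n) \sum_(B <- polys F j) (#|F|%:R ^+ j)^-1)).
    apply: (sum_cover2 (Q1 := xpredT) (Q2 := fun _ => xpredT) (h := fun j B => 'X^j + B)).
    - exact: polys_uniq.
    - by move=> j B _ _; rewrite invr_ge0 exprn_ge0 // ltW ?cardF_gt0.
    move=> m; rewrite mem_polys => sm mm; exists (degp m), (m - 'X^(degp m)); split=> //.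
    - by rewrite mem_iota /= add0n -ltnS -(monic_size mm) ltnS.
    - rewrite mem_polys; apply/leq_sizeP => j; rewrite coefB coefXn leq_eqVlt.
      case/orP => [/eqP <-|lj].
        have := mm; rewrite monicE /lead_coef -/(degp m) => /eqP ->.
        by rewrite eqxx subrr.
      by rewrite gtn_eqF // nth_default ?subr0 // (monic_size mm).
    - by rewrite addrC subrK.
  rewrite (eq_bigr (fun=> 1)) => [|j _]; last first.
    rewrite big_const_seq iter_addr_0 count_predT size_polys -[X in X *+ _]mul1r -mulrnAr.
    rewrite mul1r -mulr_natr natrX mulVf // expf_neq0 // gt_eqF ?cardF_gt0 //.
  by rewrite big_const_seq iter_addr_0 count_predT size_iota.
have -> : n%:R = \sum_(p <- [seq (j, B) | j <- iota 0 n, B <- polys F j]) (#|F|%:R ^+ p.1)^-1 :> R.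
  rewrite big_allpairs_dep /= (eq_bigr (fun=> 1)) => [|j _]; last first.
    rewrite big_const_seq iter_addr_0 count_predT size_polys -[X in X *+ _]mul1r -mulrnAr.
    rewrite mul1r -mulr_natr natrX mulVf // expf_neq0 // gt_eqF ?cardF_gt0 //.
  by rewrite big_const_seq iter_addr_0 count_predT size_iota.
apply: (sum_cover (h := fun m => (degp m, m - 'X^(degp m)))).
- apply: allpairs_uniq_dep => [|j _|[j B] [j' B'] _ _ /= [-> ->] //].
    exact: iota_uniq.
  exact: polys_uniq.
- by move=> m _; rewrite invr_ge0 ltW ?pnorm_gt0.
move=> p /allpairsPdep [j [B [lj sB ->]]] _ /=.
move: lj sB; rewrite mem_iota /= add0n mem_polys => lj sB.
have sXB : size ('X^j + B) = j.+1 by rewrite size_polyDl ?size_polyXn.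
have dXB : degp ('X^j + B) = j by rewrite /degp sXB.
exists ('X^j + B); split=> //.
- by rewrite mem_polys sXB.
- by rewrite monicE lead_coefDl ?size_polyXn // lead_coefXn.
- by rewrite dXB addrC addKr.
by rewrite /pnorm dXB.
Qed.

Variable D : nat.
Local Notation T := {poly_(D.+1) F}.
Implicit Types (K L : {set T}).

(** [K] stands for the squarefree product of its elements. Bounding its degree by [D] lets the prime
    factors live in the finite type [{poly_(D.+1) F}]. *)
Definition sieve_support K :=
  [forall P in K, `[< mi (val P) >]] && (\sum_(P in K) degp (val P) <= D)%N.

(** For k the product of [K] this is 1/phi(k), with phi Euler's function in F[t]; [sieve_mass] is
    then Selberg's sum of mu(k)^2/phi(k). *)
Definition sieve_coef K : R := \prod_(P in K) (nm (val P) - 1)^-1.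

Definition sieve_mass : R := \sum_(K | sieve_support K) sieve_coef K.

(** This is mu(P) c_P(m)/phi(P), with c_P the Ramanujan sum. Over the residues modulo P it has mean
    0 and mean square 1/phi(P). *)
Definition sieve_factor (P : {poly F}) m : R := (1 - nm P * (P %| m)%R%:R) / (nm P - 1).

(* Selberg's optimal weight, expanded in Ramanujan sums: up to the factor
   [sieve_mass] it is the sum of mu(k) c_k(m) / phi(k) over squarefree k of
   degree at most D, here indexed by their sets K of prime factors.  It is
   constant on the sifted elements, and its terms are orthogonal. *)
Definition sieve_weight m : R :=
  \sum_(K | sieve_support K) \prod_(P in K) sieve_factor (val P) m.

Lemma sieve_support_mi K P : sieve_support K -> P \in K -> mi (val P).
Proof. by case/andP => /forall_inP H _ /H /asboolP. Qed.

Lemma sieve_weight_rough m : rough D m -> sieve_weight m = sieve_mass.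
Proof.
move=> /asboolP rm; apply: eq_bigr => K sK; apply: eq_bigr => P PK.
have iP := sieve_support_mi sK PK; rewrite /sieve_factor.
have -> : (val P %| m) = false.
  apply/negP => /(rm _ iP); have := size_npoly P.
  by rewrite (monic_size (mi_monic iP)) ltnS leqNgt => /negbTE ->.
by rewrite mulr0 subr0 mul1r.
Qed.

(** By independence the sum splits into local means over the primes of the union, whose total degree
    is at most [2 * D <= k]. A prime in only one of the two sets has local mean 0; a prime in both
    contributes its mean square 1/phi(P). *)
Lemma sieve_orthogonal A k K L : (2 * D <= k)%N ->
  sieve_support K -> sieve_support L ->
  \sum_(B <- polys F k) (\prod_(P in K) sieve_factor (val P) (A + B)) *
     (\prod_(P in L) sieve_factor (val P) (A + B)) =
  if K == L then #|F|%:R ^+ k * sieve_coef K else 0.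
Proof.
move=> dk sK sL.
pose both (P : {poly F}) := [exists Q in K :&: L, val Q == P].
(* The coefficients make [a P + b P * [P | m]] equal to [sieve_factor P m] when [P] lies in just one
   set, and to its square when [P] lies in both. *)
pose a P : R := if both P then (nm P - 1) ^- 2 else (nm P - 1)^-1.
pose b P : R := if both P then (nm P ^+ 2 - nm P *+ 2) / (nm P - 1) ^+ 2
  else - nm P / (nm P - 1).
have bothE P : both (val P) = (P \in K :&: L).
  apply/exists_inP/idP => [[Q QKL /eqP/val_inj <-] //|PKL].
  by exists P.
have miKL P : P \in K :|: L -> mi (val P).
  by rewrite inE => /orP[]; apply: sieve_support_mi.
pose ps := [seq val P | P <- enum (K :|: L)].
have ips : {in ps, forall P, mi P}.
  by move=> _ /mapP[P PKL ->]; apply: miKL; rewrite mem_enum in PKL.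
have ups : uniq ps by rewrite map_inj_uniq ?enum_uniq //; exact: val_inj.
have prodKL B : (\prod_(P in K) sieve_factor (val P) (A + B)) *
     (\prod_(P in L) sieve_factor (val P) (A + B)) =
     \prod_(P <- ps) (a P + b P * (P %| A + B)%R%:R).
  rewrite big_map big_enum /= [in RHS](big_setID K) /= finset.setUK finset.setDUl finset.setDv finset.set0U.
  rewrite (big_setID L (A := K)) /= (big_setID K (A := L)) /=.
  rewrite [L :&: K]finset.setIC mulrACA -big_split /=.
  rewrite [in RHS](big_setID L) /= -mulrA; congr (_ * (_ * _)).
  - apply: eq_bigr => P PKL; rewrite /a /b bothE PKL /sieve_factor.
    have : nm (val P) - 1 != 0.
      rewrite subr_eq0 gt_eqF // pnorm_gt1 //; apply: miKL.
      by move: PKL; rewrite !inE => /andP[->].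
    by case: (val P %| _) => /= h; field.
  - apply: eq_bigr => P; rewrite !inE => /andP[PL PK].
    rewrite /a /b bothE !inE (negbTE PL) andbF /sieve_factor.
    by rewrite mulrBl mul1r mulNr mulNr mulrAC.
  apply: eq_bigr => P; rewrite !inE => /andP[PK PL].
  rewrite /a /b bothE !inE (negbTE PK) /sieve_factor.
  by rewrite mulrBl mul1r mulNr mulNr mulrAC.
under eq_bigr => B _ do rewrite prodKL.
rewrite (eq_bigl (fun B => 1 %| A + B)); last by move=> B; rewrite dvd1p.
rewrite sum_multiples_prod ?monic1 //; last first.
- rewrite degp1 add0n (leq_trans _ dk) // big_map big_enum /= mul2n -addnn.
  have [/andP[_ dK] /andP[_ dL]] := (sK, sL).
  apply: leq_trans (leq_add dK dL); rewrite (big_setID K) /= finset.setUK leq_add2l.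
  rewrite finset.setDUl finset.setDv finset.set0U; rewrite [X in (_ <= X)%N](big_setID K) /=.
  exact: leq_addl.
- by move=> P _; rewrite coprimep_sym coprimep1.
have -> : nm 1 = 1 by rewrite /pnorm degp1.
rewrite divr1 big_map big_enum /=.
case: eqP => [e|/eqP neKL].
  congr (_ * _); rewrite -e finset.setUid; apply: eq_bigr => P PK.
  rewrite /a /b bothE -e finset.setIid PK.
  have h1 : nm (val P) - 1 != 0.
    by rewrite subr_eq0 gt_eqF // pnorm_gt1 //; apply: (sieve_support_mi sK).
  have h2 := lt0r_neq0 (pnorm_gt0 R (val P)).
  by field; rewrite h1 h2.
suff [P PKL PnKL] : exists2 P, P \in K :|: L & P \notin K :&: L.
  rewrite (bigD1 P) //= /a /b bothE (negbTE PnKL).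
  have h1 : nm (val P) - 1 != 0 by rewrite subr_eq0 gt_eqF // pnorm_gt1 //; apply: miKL.
  have h2 := lt0r_neq0 (pnorm_gt0 R (val P)).
  set X := _ + _; suff -> : X = 0 by rewrite mul0r mulr0.
  by rewrite /X; field; rewrite h1 h2.
apply/exists_inP; apply: contraNT neKL; rewrite negb_exists => /forallP H.
apply/eqP/setP => P; have := H P; rewrite !inE.
by case: (P \in K); case: (P \in L).
Qed.

(* Group the monic m of degree at most D by their radical. *)
Lemma sieve_mass_ge : D.+1%:R <= sieve_mass.
Proof.
rewrite -sum_monic_inv_pnorm /sieve_mass.
pose supp m := [set P : T | `[< mi (val P) >] && (val P %| m)]%SET.
pose pK K := [seq val P | P <- enum K].
apply: (@le_trans _ _ (\sum_(K <- index_enum _ | sieve_support K)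
   \sum_(m <- polys F D.+1 | [&& m \is monic,
       `[< forall P, mi P -> P %| m -> P \in pK K >] &
       (1 == 1)%N ==> all (fun P => P %| m) (pK K)]) (nm m)^-1)).
  apply: (sum_cover2 (h := fun _ m => m)); first exact: polys_uniq.
    by move=> *; rewrite invr_ge0 ltW ?pnorm_gt0.
  move=> m; rewrite mem_polys => sm mm; exists (supp m), m; split=> //.
  - by rewrite mem_polys.
  - apply/and4P; split=> //.
    + apply/andP; split.
        by apply/forall_inP => P; rewrite inE => /andP[].
      apply: (@leq_trans (degp m)); last by rewrite -ltnS -monic_size.
      rewrite -big_enum -(big_map val xpredT (@degp F)) -degp_prod; last first.
        move=> x /mapP[P]; rewrite mem_enum inE => /andP[/asboolP iP _] ->.
        exact: mi_monic.
      apply: monic_dvd_degp => //; apply: prod_primes_dvd.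
      * by rewrite map_inj_uniq ?enum_uniq //; exact: val_inj.
      * by move=> x /mapP[P]; rewrite mem_enum inE => /andP[/asboolP iP _] ->.
      * by move=> x /mapP[P]; rewrite mem_enum inE => /andP[_ dP] ->.
    + apply/asboolP => P iP dP; have sP : (size P <= D.+1)%N.
        by rewrite (leq_trans _ sm) // dvdp_leq // monic_neq0.
      apply/mapP; exists (NPoly sP) => //; rewrite mem_enum inE /= dP andbT.
      exact/asboolP.
    by apply/allP => x /mapP[P]; rewrite mem_enum inE => /andP[_ dP] ->.
apply: ler_sum => K sK.
apply: (le_trans (euler_product_le (f := fun m => (nm m)^-1) _ _ _ _ _ _ _)) => //.
- by rewrite /pnorm degp1 expr0 invr1.
- by move=> m _; rewrite invr_ge0 ltW ?pnorm_gt0.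
- by move=> A B mA mB _; rewrite pnormM // invfM.
- by rewrite map_inj_uniq ?enum_uniq //; exact: val_inj.
- by move=> _ /mapP[P PK ->]; apply: (sieve_support_mi sK); rewrite mem_enum in PK.
rewrite big_map big_enum /=; apply: ler_prod => P PK; apply/andP; split.
  by apply: sumr_ge0 => l _; rewrite invr_ge0 ltW ?pnorm_gt0.
have iP := sieve_support_mi sK PK.
have h1 := pnorm_gt1 R iP; have h0 := pnorm_gt0 R (val P).
under eq_bigr => l _ do rewrite (pnormX _ _ (mi_monic iP)) -exprVn.
apply: (le_trans (sum_geom_le 1 D.+1 _ _)).
- by rewrite invr_ge0 ltW.
- by rewrite invf_lt1.
(* The full geometric series from exponent 1 is exactly 1/(|P| - 1), the factor of [sieve_coef] at
   [P]. *)
rewrite expr1 le_eqVlt; apply/orP; left; apply/eqP; field.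
by rewrite subr_eq0 !gt_eqF.
Qed.

(** A second moment argument: the weight equals [sieve_mass] on rough elements, while by
    orthogonality its squares sum to [#|F| ^ k * sieve_mass]. Hence the count is at most
    [#|F| ^ k / sieve_mass]. *)
Lemma sieve_upper_bound A k : (2 * D <= k)%N ->
  \sum_(B <- polys F k | rough D (A + B)) 1 <= #|F|%:R ^+ k / D.+1%:R :> R.
Proof.
move=> dk; have S1 := sieve_mass_ge.
have S0 : 0 < sieve_mass by apply: lt_le_trans S1; rewrite ltr0n.
have q0 : 0 <= #|F|%:R ^+ k :> R by rewrite exprn_ge0 // ltW ?cardF_gt0.
have W2 : \sum_(B <- polys F k) sieve_weight (A + B) ^+ 2 = #|F|%:R ^+ k * sieve_mass.
  under eq_bigr => B _.
    rewrite expr2 {1}/sieve_weight mulr_suml.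
    under eq_bigr => K sK do rewrite /sieve_weight mulr_sumr.
    over.
  rewrite /= exchange_big /= /sieve_mass mulr_sumr; apply: eq_bigr => K sK.
  rewrite exchange_big /= (bigD1 K) //= sieve_orthogonal // eqxx.
  rewrite big1 ?addr0 // => L /andP[sL neLK].
  by rewrite sieve_orthogonal // eq_sym (negbTE neLK).
have le1 : sieve_mass ^+ 2 * \sum_(B <- polys F k | rough D (A + B)) 1 <=
    #|F|%:R ^+ k * sieve_mass.
  rewrite -W2 mulr_sumr big_mkcond; apply: ler_sum => B _.
  case: ifP => [/sieve_weight_rough ->|_]; last exact: sqr_ge0.
  by rewrite mulr1.
rewrite ler_pdivlMr ?ltr0n //.
rewrite expr2 [leRHS]mulrC -mulrA ler_pM2l // mulrC in le1.
apply: le_trans le1; apply: ler_wpM2l => //.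
by apply: sumr_ge0.
Qed.

End SelbergSieve.

(** * Sums over smooth polynomials *)

Section SmoothSums.
Variables (R : realType) (F : finFieldType).
Implicit Types (A B P Q m : {poly F}) (n k : nat) (ps : seq {poly F}).
Local Notation mi := (monic_irreducible F).
Local Notation nm := (@pnorm R F).

(** A Chebyshev bound drawn from the sieve itself: a prime of degree [n] has no prime factor of
    degree at most [n %/ 2], and [(n %/ 2).+1 >= n / 2]. *)
Lemma sum_primes_deg n w : (0 < n)%N ->
  \sum_(P <- primes_le F w | degp P == n) 1 <= #|F|%:R ^+ n * (2 / n%:R) :> R.
Proof.
move=> n0; pose D := (n %/ 2)%N.
have dD : (2 * D <= n)%N by rewrite mulnC leq_divM.
have := @sieve_upper_bound R F D 'X^n n dD.
have le2 : #|F|%:R ^+ n / D.+1%:R <= #|F|%:R ^+ n * (2 / n%:R) :> R.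
  rewrite ler_pM2l ?exprn_gt0 ?cardF_gt0 // ler_pdivlMr ?ltr0n //.
  rewrite mulrC ler_pdivrMr ?ltr0n // -natrM ler_nat.
  by rewrite /D mulnC -[(_ * 2)%N]mulnC; have := ltn_ceil n (ltn0Sn 1); lia.
move=> H; apply: le_trans le2; apply: le_trans H.
apply: (sum_cover (h := fun B => 'X^n + B)) => //; first exact: primes_le_uniq.
move=> P; rewrite mem_primes_le => /asboolP[iP _] /eqP dP.
have mP := mi_monic iP.
exists (P - 'X^n); split=> //; last by rewrite addrC subrK.
  rewrite mem_polys; apply/leq_sizeP => j; rewrite coefB coefXn leq_eqVlt.
  case/orP => [/eqP <-|lj].
    have := mP; rewrite monicE /lead_coef -/(degp P) dP => /eqP ->.
    by rewrite eqxx subrr.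
  by rewrite gtn_eqF // nth_default ?subr0 // (monic_size mP) dP.
rewrite addrC subrK; apply/asboolP => Q iQ /(mi_dvd_mi iQ iP) ->.
by rewrite dP /D ltn_Pdiv.
Qed.

Lemma sum_primes_le (phi : nat -> R) w : (forall n, 0 <= phi n) ->
  \sum_(P <- primes_le F w) phi (degp P) / nm P <=
  \sum_(n <- iota 1 w) 2 / n%:R * phi n.
Proof.
move=> phi0; apply: (@le_trans _ _ (\sum_(n <- iota 1 w)
   \sum_(P <- primes_le F w | degp P == n) phi n / #|F|%:R ^+ n)).
  apply: (sum_cover2 (h := fun _ P => P)); first exact: primes_le_uniq.
    by move=> n P _ _; rewrite divr_ge0 // exprn_ge0 // ler0n.
  move=> P sP _; exists (degp P), P; split=> //=.
  move: sP; rewrite mem_primes_le mem_iota => /asboolP[iP dP].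
  by rewrite mi_degp //= add1n ltnS.
rewrite big_seq_cond [leRHS]big_seq_cond; apply: ler_sum => n.
rewrite mem_iota andbT => /andP[n0 _].
rewrite -[X in \sum_(_ <- _ | _) X]mulr1 -mulr_sumr.
rewrite -mulrA [leRHS]mulrC; apply: ler_wpM2l => //.
rewrite ler_pdivrMl ?exprn_gt0 ?cardF_gt0 //.
exact: sum_primes_deg.
Qed.

Definition smooth w m := `[< forall P, mi P -> P %| m -> (degp P <= w)%N >].

Variable (g : {poly F} -> R) (C0 : R).
Hypothesis g_ge0 : forall m, m \is monic -> 0 <= g m.
Hypothesis g_mul : multiplicative_on_monics g.
Hypothesis g_le : forall m, m \is monic -> g m <= C0 * (10 / 9) ^+ degp m.

(** In the Euler product, each local sum is at most 1 + f(P) + c(P) <= exp(f(P) + c(P)), where c(P)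
    bounds the contribution of exponents at least 2. The c(P) form a convergent series, bounded
    uniformly in the field. *)
Lemma smooth_sum_le theta w n : 0 <= theta -> expR theta <= 9 / 8 ->
  \sum_(b <- polys F n | (b \is monic) && smooth w b)
     g b * expR (theta * (degp b)%:R) / nm b <=
  expR (25 * C0) *
  expR (\sum_(P <- primes_le F w) g P * expR (theta * (degp P)%:R) / nm P).
Proof.
move=> th0 th1; case: g_mul => g1 gM.
have C0_ge0 : 0 <= C0.
  have := g_le (monic1 _); rewrite g1 degp1 expr0 mulr1; exact/le_trans/ler01.
pose f b := g b * expR (theta * (degp b)%:R) / nm b.
have f0 m : m \is monic -> 0 <= f m.
  by move=> mm; rewrite divr_ge0 ?mulr_ge0 ?g_ge0 ?expR_ge0 // ltW ?pnorm_gt0.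
have fM A B : A \is monic -> B \is monic -> coprimep A B -> f (A * B) = f A * f B.
  move=> mA mB cAB; rewrite /f gM // degpM // pnormM // natrD mulrDr expRD invfM.
  by ring.
have f1 : f 1 = 1 by rewrite /f g1 /pnorm degp1 mulr0 expR0 expr0 invr1 !mulr1.
have E := @euler_product_le R F f n 0 (primes_le F w) isT f1 f0 fM (primes_le_uniq F w).
have ips : {in primes_le F w, forall P, mi P}.
  by move=> P; rewrite mem_primes_le => /asboolP[].
have {E} := E ips; rewrite [X in X <= _ -> _](_ : _ =
    \sum_(b <- polys F n | (b \is monic) && smooth w b) f b); last first.
  apply: eq_bigl => m; rewrite /= andbT; congr (_ && _); apply/asboolP/asboolP.
    by move=> H P iP dP; have := H P iP dP; rewrite mem_primes_le => /asboolP[].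
  by move=> H P iP dP; rewrite mem_primes_le; apply/asboolP; split=> //; apply: H.
move=> E; apply: le_trans E _; rewrite -expRD.
pose c P := C0 * (8 / 3) * ((25 / 32) ^+ degp P / nm P).
apply: (@le_trans _ _ (\prod_(P <- primes_le F w) expR (f P + c P))).
  rewrite big_seq [leRHS]big_seq; apply: ler_prod => P Pw.
  have iP := ips P Pw; have mP := mi_monic iP.
  apply/andP; split; first by apply: sumr_ge0 => l _; apply/f0/monic_exp.
  apply: (@le_trans _ _ (1 + (f P + c P))); last exact: expR_ge1Dx.
  (* The growth of [g] and of the exponential combine to 10/9 * 9/8 = 5/4, whence
     [f (P ^+ l) <= C0 * x ^+ l]. As q >= 2, [x <= 5/8], so that 1/(1 - x) <= 8/3, and x^2 <=
     (25/32)^deg P / |P|. *)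
  pose x : R := (5 / 4 / #|F|%:R) ^+ degp P.
  have q2 : 2 <= #|F|%:R :> R by rewrite ler_nat card_field_gt1.
  have qgt0 := cardF_gt0 R F.
  have t0 : 0 <= 5 / 4 / #|F|%:R :> R by rewrite divr_ge0 // ltW.
  have t58 : 5 / 4 / #|F|%:R <= 5 / 8 :> R by rewrite ler_pdivrMr //; lra.
  have x0 : 0 <= x by rewrite exprn_ge0.
  have x58 : x <= 5 / 8.
    rewrite /x; have := mi_degp iP; case: (degp P) => // v _; rewrite exprS.
    have t1 : 5 / 4 / #|F|%:R <= 1 :> R by rewrite (le_trans t58) //; lra.
    by rewrite (le_trans _ t58) // ler_piMr // exprn_ile1.
  have fPl l : f (P ^+ l) <= C0 * x ^+ l.
    rewrite /f /x.
    have -> : nm (P ^+ l) = #|F|%:R ^+ (degp P * l) by rewrite pnormX // /pnorm exprM.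
    rewrite ler_pdivrMr ?exprn_gt0 // -exprM -[leRHS]mulrA -exprMn divfK ?gt_eqF //.
    have gl := g_le (monic_exp l mP).
    have el : expR (theta * (degp (P ^+ l))%:R) <= (9 / 8) ^+ degp (P ^+ l).
      by rewrite expRM_natr; apply: lerXn2r; rewrite ?nnegrE ?expR_ge0 //; lra.
    have := ler_pM (g_ge0 (monic_exp l mP)) (expR_ge0 _) gl el.
    rewrite -mulrA -exprMn degpX // mulnC => H; apply: le_trans H _.
    by rewrite ler_wpM2l //; apply: lerXn2r; rewrite ?nnegrE //; lra.
  have c2 k : \sum_(l <- iota 2 k) f (P ^+ l) <= c P.
    apply: (@le_trans _ _ (C0 * \sum_(l <- iota 2 k) x ^+ l)).
      by rewrite mulr_sumr; apply: ler_sum => l _.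
    rewrite /c -mulrA ler_wpM2l //.
    apply: le_trans (sum_geom_le 2 k x0 _) _; first by lra.
    have x2 : x ^+ 2 <= (25 / 32) ^+ degp P / nm P.
      rewrite ler_pdivlMr ?pnorm_gt0 // /x /pnorm -exprM mulnC exprM -exprMn.
      apply: lerXn2r; rewrite ?nnegrE ?mulr_ge0 ?exprn_ge0 //.
      have -> : (5 / 4 / #|F|%:R) ^+ 2 * #|F|%:R = 25 / 16 / #|F|%:R :> R.
        by field; rewrite gt_eqF.
      by rewrite ler_pdivrMr //; lra.
    have i38 : (1 - x)^-1 <= 8 / 3 by rewrite -[_^-1]mul1r ler_pdivrMr; lra.
    have x20 : 0 <= x ^+ 2 by rewrite exprn_ge0.
    rewrite mulrC; apply: ler_pM => //; rewrite invr_ge0; lra.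
  have c20 : 0 <= c P by have := c2 0%N; rewrite /= big_nil.
  case: n => [|[|n']].
  - by rewrite big_nil; have := f0 P mP; lra.
  - by rewrite big_seq1 expr0 f1; have := f0 P mP; lra.
  by rewrite /= 2!big_cons expr0 f1 expr1; have := c2 n'; lra.
rewrite -expR_sum ler_expR big_split /= addrC lerD2r /c -mulr_sumr.
rewrite -(mulrA C0) (mulrC 25 C0); apply: ler_wpM2l => //.
(* The resulting constant is 8/3 * 2 * 25/7 = 400/21, which is below 25. *)
apply: (@le_trans _ _ (8 / 3 * \sum_(l <- iota 1 w) 2 / l%:R * (25 / 32) ^+ l)).
  rewrite ler_wpM2l //; apply: (@sum_primes_le (fun n => (25 / 32) ^+ n)).
  by move=> k; rewrite exprn_ge0.
apply: (@le_trans _ _ (8 / 3 * (2 * \sum_(l <- iota 1 w) (25 / 32) ^+ l))).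
  rewrite ler_wpM2l // mulr_sumr big_seq [leRHS]big_seq; apply: ler_sum => l.
  rewrite mem_iota => /andP[l0 _]; rewrite ler_wpM2r ?exprn_ge0 //.
  by rewrite ler_pdivrMr ?ltr0n // ler_peMr // ler1n.
have := @sum_geom_le R (25 / 32) 1 w; rewrite expr1 => H.
have := H _ _; have -> : 25 / 32 / (1 - 25 / 32) = 25 / 7 :> R by field.
by move=> H'; have {}H' : _ := H' _ _; lra.
Qed.

(** Removing the exponential twist from the prime sum costs at most the sum of
    [|A1| * theta * degp P * expR b / |P|] over primes of degree at most [w]. By the Chebyshev bound
    each degree contributes at most [2 * theta], apart from the constant [|A1| * expR b], hence the
    total involves only [theta * w <= b]. *)
Lemma smooth_sum_rankin (A1 theta b : R) w n : 0 <= theta -> expR theta <= 9 / 8 ->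
  (forall P, mi P -> g P <= A1) -> theta * w%:R <= b ->
  \sum_(m <- polys F n | (m \is monic) && smooth w m)
     g m * expR (theta * (degp m)%:R) / nm m <=
  expR (25 * C0 + 2 * `|A1| * b * expR b) *
  expR (\sum_(P <- primes_le F w) g P / nm P).
Proof.
move=> th0 th1 gA1 thb; apply: le_trans (smooth_sum_le w n th0 th1) _.
rewrite expRD -mulrA ler_pM2l ?expR_gt0 // -expRD ler_expR addrC -lerBlDl -sumrB.
apply: (@le_trans _ _ (`|A1| * \sum_(P <- primes_le F w)
    (theta * (degp P)%:R * expR b) / nm P)).
  rewrite mulr_sumr big_seq [leRHS]big_seq; apply: ler_sum => P.
  rewrite mem_primes_le => /asboolP[iP dP]; rewrite -mulrBl mulrA.
  rewrite ler_pM2r ?invr_gt0 ?pnorm_gt0 // -{2}[g P]mulr1 -mulrBr.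
  have t0 : 0 <= theta * (degp P)%:R by rewrite mulr_ge0.
  have tb : theta * (degp P)%:R <= b.
    by apply: le_trans thb; rewrite ler_wpM2l // ler_nat.
  have e1 : 0 <= expR (theta * (degp P)%:R) - 1 by rewrite subr_ge0 -[X in X <= _]expR0 ler_expR.
  have e2 : expR (theta * (degp P)%:R) - 1 <= theta * (degp P)%:R * expR b.
    move: t0 tb; set t := _ * _ => t0 tb.
    apply: (@le_trans _ _ (t * expR t)); last by rewrite ler_wpM2l // ler_expR.
    (* Multiplying 1 - t <= exp(-t) by exp(t) gives exp(t) - 1 <= t exp(t). *)
    have := expR_ge1Dx (- t); rewrite expRN => H.
    have := ler_wpM2r (expR_ge0 t) H; rewrite mulVf ?gt_eqF ?expR_gt0 //; lra.
  apply: ler_pM => //; first exact/g_ge0/mi_monic.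
  exact: le_trans (gA1 P iP) (ler_norm _).
have -> : 2 * `|A1| * b * expR b = `|A1| * (2 * b * expR b) by ring.
have S := @sum_primes_le (fun n => theta * n%:R * expR b) w.
apply: ler_wpM2l => //; apply: le_trans (S _) _.
  by move=> k; rewrite !mulr_ge0 ?expR_ge0.
rewrite (eq_big_seq (fun=> 2 * theta * expR b)); last first.
  move=> k; rewrite mem_iota => /andP[k0 _]; field.
  by rewrite pnatr_eq0 -lt0n.
rewrite big_const_seq iter_addr_0 count_predT size_iota -[X in X <= _]mulr_natr.
have -> : 2 * theta * expR b * w%:R = (theta * w%:R) * (2 * expR b) by ring.
have := ler_wpM2r (_ : 0 <= 2 * expR b) thb; rewrite mulr_ge0 ?expR_ge0 // => H.
by apply: le_trans (H isT) _; rewrite le_eqVlt; apply/orP; left; apply/eqP; ring.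
Qed.

End SmoothSums.

(** * Smooth-rough factorizations *)

Section Decomposition.
Variable F : finFieldType.
Implicit Types (A B P Q m b d : {poly F}) (n k y w N h : nat).
Local Notation mi := (monic_irreducible F).

Lemma smoothW w w' m : (w <= w')%N -> smooth w m -> smooth w' m.
Proof.
by move=> ww /asboolP H; apply/asboolP => P iP dP; apply: leq_trans (H P iP dP) ww.
Qed.

Lemma roughW w w' m : (w' <= w)%N -> rough w m -> rough w' m.
Proof.
by move=> ww /asboolP H; apply/asboolP => P iP dP; apply: leq_ltn_trans ww (H P iP dP).
Qed.

(** The exponent [(y %/ degp P).+1] is the least for which the power has degree above [y]; that
    degree is then at most [2 * y]. *)
Definition has_large_power y m :=
  `[< exists P, [/\ mi P, (degp P <= y)%N & P ^+ (y %/ degp P).+1 %| m] >].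

(** Since [rough] is a strict condition, the predecessor expresses that [P] has minimal degree among
    the prime factors. *)
Lemma exists_min_prime_factor m : m \is monic -> m != 1 ->
  exists P, [/\ mi P, P %| m & rough (degp P).-1 m].
Proof.
move=> mm m1; pose p k := `[< exists P, [/\ mi P, P %| m & degp P = k] >].
have exp : exists k, p k.
  have [P iP dP] := exists_prime_factor mm m1.
  by exists (degp P); apply/asboolP; exists P.
case: (ex_minnP exp) => k /asboolP[P [iP dP eP]] mink.
exists P; split=> //; apply/asboolP => Q iQ dQ; rewrite prednK ?mi_degp // eP.
by apply: mink; apply/asboolP; exists Q.
Qed.

(** Greedy transfer from [d] to [b] of the exact power of a prime [P] of least degree, stopping with
    [w = degp P] once [degp P > y] or [degp b >= 2 * y]. Each transfer starts below degree [2 * y]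
    and adds at most [y]. *)
Lemma smooth_rough_factorization y m : m \is monic -> (3 * y < degp m)%N ->
  ~~ has_large_power y m ->
  exists b d w, [/\ b \is monic, d \is monic, m = b * d & coprimep b d] /\
    [/\ (0 < w)%N, (degp b <= 3 * y)%N, smooth w b, rough w.-1 d &
        (y < w)%N || (2 * y <= degp b)%N && (w <= y)%N].
Proof.
move=> mm dm nbad.
(* Invariant of the transfer: primes of [b] never exceed those of [d] in degree, and
   [degp b <= 3 * y < degp m], so [d] is never exhausted. *)
suff claim n : forall b d, (degp d < n)%N -> b \is monic -> d \is monic ->
    m = b * d -> coprimep b d -> (degp b <= 3 * y)%N ->
    (forall P Q, mi P -> mi Q -> P %| b -> Q %| d -> (degp P <= degp Q)%N) ->
    exists b d w, [/\ b \is monic, d \is monic, m = b * d & coprimep b d] /\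
    [/\ (0 < w)%N, (degp b <= 3 * y)%N, smooth w b, rough w.-1 d &
        (y < w)%N || (2 * y <= degp b)%N && (w <= y)%N].
  apply: (claim _ 1 m (ltnSn _)); rewrite ?monic1 ?mul1r ?coprime1p ?degp1 //.
  move=> P Q iP iQ dP; have := mi_coprime 1 iP.
  by rewrite coprimep1 dP.
elim: n => // n IH b d; rewrite ltnS => dd mb md em cbd db ord.
have d1 : d != 1.
  by apply: contraTneq dm => e; rewrite em e mulr1 -leqNgt.
have [P [iP dP rP]] := exists_min_prime_factor md d1.
have mP := mi_monic iP; have P0 := mi_degp iP.
have sb : smooth (degp P) b by apply/asboolP => Q iQ dQ; apply: ord.
have [wy|wy] := ltnP y (degp P); first by exists b, d, (degp P); rewrite wy.
have [yb|by2] := leqP (2 * y) (degp b).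
  by exists b, d, (degp P); rewrite wy yb orbT.
have [e [d' [md' ed nd e0]]] := prime_power_split iP md.
have mPe := monic_exp e mP; have mbPe : b * P ^+ e \is monic by rewrite monicMl.
have e_small : (e * degp P <= y)%N.
  rewrite -leq_divRL // leqNgt; apply: contra nbad => ey; apply/asboolP.
  exists P; split=> //; rewrite em ed.
  apply: dvdp_trans (dvdp_trans (dvdp_mulIl _ d') (dvdp_mulIr b _)).
  exact: dvdp_exp2l.
have d'd : d' %| d by rewrite ed dvdp_mulIr.
apply: (IH (b * P ^+ e) d') => //.
- apply: leq_trans dd; rewrite ed degpM // degpX // -[X in (X < _)%N]add0n.
  by rewrite ltn_add2r muln_gt0 e0.
- by rewrite -mulrA -ed.
- by rewrite coprimepMl (coprimep_dvdl d'd cbd) coprimep_expl // mi_coprime.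
- by rewrite degpM // degpX //; clear -e_small by2; lia.
move=> Q1 Q2 iQ1 iQ2 /(mi_dvdM iQ1)/orP[dQ1|/(mi_dvdX iQ1) dQ1] dQ2.
  by apply: ord => //; apply: dvdp_trans dQ2 d'd.
rewrite (mi_dvd_mi iQ1 iP dQ1); move/asboolP: rP => /(_ Q2 iQ2).
by rewrite prednK //; apply; apply: dvdp_trans dQ2 d'd.
Qed.

End Decomposition.

(** * Sieving the cofactors in a short interval *)

Section IntervalSums.
Variables (R : realType) (F : finFieldType) (N h : nat) (A : {poly F}).
Implicit Types (B P Q m b d : {poly F}) (n k y w D : nat).
Local Notation mi := (monic_irreducible F).
Local Notation nm := (@pnorm R F).

Definition in_interval m :=
  [&& m \is monic, degp m == N & (size (m - A)%R <= h.+1)%N].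

Lemma sum_interval_multiples b : b \is monic -> (degp b <= h.+1)%N ->
  \sum_(m <- polys F N.+1 | in_interval m && (b %| m)) 1 <= #|F|%:R ^+ h.+1 / nm b.
Proof.
move=> mb db; rewrite -(sum_multiples R A mb db).
apply: (sum_cover (h := fun B => A + B)) => //; first exact: polys_uniq.
move=> m _ /andP[/and3P[_ _ sm] dm]; exists (m - A).
by rewrite subrKC mem_polys.
Qed.

(** Dividing by [b] turns the interval about [A] into one about [A %/ b] with [h.+1 - degp b] free
    coefficients, which leaves room for a sieve of level [D]. *)
Lemma sum_interval_rough b D : b \is monic -> (degp b + 2 * D <= h.+1)%N ->
  \sum_(d <- polys F N.+1 | in_interval (b * d) && rough D d) 1 <=
    #|F|%:R ^+ h.+1 / nm b / D.+1%:R.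
Proof.
move=> mb db; have dbh : (degp b <= h.+1)%N by apply: leq_trans db; exact: leq_addr.
have -> : #|F|%:R ^+ h.+1 / nm b = #|F|%:R ^+ (h.+1 - degp b).
  by rewrite -[in LHS](subnK dbh) exprD /pnorm mulfK // gt_eqF ?exprn_gt0 ?cardF_gt0.
apply: le_trans (@sieve_upper_bound R F D (A %/ b) (h.+1 - degp b) _); last by clear -db; lia.
apply: (sum_cover (h := fun B => A %/ b + B)) => //; first exact: polys_uniq.
move=> d _ /andP[/and3P[_ _ sm] rd]; exists (d - A %/ b).
have e : A %/ b + (d - A %/ b) = d by rewrite addrC subrK.
rewrite e; split=> //; rewrite mem_polys; set B := _ - _ in e *.
have [->|B0] := eqVneq B 0; first by rewrite size_poly0.
have szbB : size (b * B) = (degp b + size B)%N.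
  by rewrite size_mul ?(monic_neq0 mb) // (monic_size mb).
rewrite leq_subRL // -szbB.
have -> : b * B = (b * d - A) + A %% b.
  by rewrite {1}(divp_eq A b) /B; ring.
rewrite (leq_trans (size_polyD _ _)) // geq_max sm /=.
by rewrite (leq_trans _ dbh) // -ltnS -(monic_size mb) ltn_modp monic_neq0.
Qed.

Variables (g : {poly F} -> R) (a : R).
Hypothesis g_ge0 : forall m, m \is monic -> 0 <= g m.
Hypothesis g_mul : multiplicative_on_monics g.
Hypothesis a_ge1 : 1 <= a.
Hypothesis g_pow : forall P l, mi P -> (0 < l)%N -> g (P ^+ l) <= a ^+ l.

(** Counted with multiplicity, [d] has at most [degp d %/ D.+1] prime factors, each costing a factor
    [a >= 1]. *)
Lemma rough_le D d : d \is monic -> rough D d -> g d <= a ^+ (degp d %/ D.+1).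
Proof.
have a0 : 0 <= a by apply: le_trans a_ge1.
case: g_mul => g1 gM; have [n] := ubnP (degp d).
elim: n d => // n IH d; rewrite ltnS => dn md rd.
have [->|d1] := eqVneq d 1; first by rewrite g1 degp1 div0n expr0.
have [P iP dP] := exists_prime_factor md d1; have mP := mi_monic iP.
have [l [d' [md' ed nd l0]]] := prime_power_split iP md.
have DP : (D < degp P)%N by move/asboolP: rd; apply.
have degd : degp d = (l * degp P + degp d')%N by rewrite ed degpM ?monic_exp // degpX.
rewrite {1}ed gM ?monic_exp //; last by rewrite coprimep_expl // mi_coprime.
apply: (@le_trans _ _ (a ^+ l * a ^+ (degp d' %/ D.+1))).
  apply: ler_pM; rewrite ?g_ge0 ?monic_exp ?g_pow ?l0 //; apply: IH => //.
    by apply: leq_trans dn; rewrite degd -[X in (X < _)%N]add0n ltn_add2r muln_gt0 l0 ?mi_degp.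
  apply/asboolP => Q iQ dQ; move/asboolP: rd; apply=> //.
  by rewrite ed dvdp_mull.
rewrite -exprD; apply: ler_weXn2l => //; rewrite leq_divRL // degd mulnDl.
by apply: leq_add; [rewrite leq_mul2l DP orbT|exact: leq_trunc_div].
Qed.

(** Coprimality splits [g m] as [g b * g d]; the second factor is bounded uniformly and the [d] are
    counted for each [b]. Several factorizations of one [m] only increase the right side. *)
Lemma sum_smooth_rough_le (p : pred {poly F}) D :
  (forall b, b \is monic -> p b -> (degp b + 2 * D <= h.+1)%N) ->
  \sum_(m <- polys F N.+1 | in_interval m && `[< exists b d,
       [/\ b \is monic, d \is monic, m = b * d & coprimep b d] /\
       p b /\ rough D d >]) g m <=
  #|F|%:R ^+ h.+1 * (a ^+ (N %/ D.+1) / D.+1%:R) *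
    \sum_(b <- polys F N.+1 | (b \is monic) && p b) g b / nm b.
Proof.
move=> pD; have a0 : 0 <= a by apply: le_trans a_ge1.
apply: (@le_trans _ _ (\sum_(b <- polys F N.+1 | (b \is monic) && p b)
  \sum_(d <- polys F N.+1 | in_interval (b * d) && rough D d)
     g b * a ^+ (N %/ D.+1))).
  apply: (sum_cover2 (h := fun b d => b * d)); first exact: polys_uniq.
    by move=> b d /andP[mb _] _; rewrite mulr_ge0 ?g_ge0 ?exprn_ge0.
  move=> m _ /andP[im /asboolP[b [d [[mb md em cbd] [pb rd]]]]].
  have degm : (degp b + degp d = N)%N.
    by case/and3P: im => _ /eqP <- _; rewrite em degpM.
  exists b, d; split=> //; rewrite ?mem_polys.
  - by rewrite (monic_size mb) ltnS -degm leq_addr.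
  - by rewrite (monic_size md) ltnS -degm leq_addl.
  - by rewrite mb pb -em im rd.
  case: g_mul => _ gM; rewrite em gM // ler_wpM2l ?g_ge0 //.
  apply: le_trans (rough_le md rd) _; apply: ler_weXn2l => //.
  by apply: leq_div2r; rewrite -degm leq_addl.
rewrite mulr_sumr; apply: ler_sum => b /andP[mb pb].
rewrite -[X in \sum_(_ <- _ | _) X]mulr1 -mulr_sumr.
have := sum_interval_rough mb (pD b mb pb).
have ga : 0 <= g b * a ^+ (N %/ D.+1) by rewrite mulr_ge0 ?g_ge0 ?exprn_ge0.
move/(ler_wpM2l ga) => H; apply: le_trans H _.
by rewrite le_eqVlt; apply/orP; left; apply/eqP; ring.
Qed.

End IntervalSums.

(** * Sparse classes *)

Section Numerics.
Variable R : realType.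

(** Bernoulli's inequality at 20/19, whose square 400/361 is less than 10/9; the constant is
    19^2. *)
Lemma sqr_geom_le (n : nat) : n%:R ^+ 2 * (9 / 10) ^+ n <= 361 :> R.
Proof.
have bern : n%:R / 19 <= (20 / 19) ^+ n :> R.
  have : 1 + n%:R / 19 <= (20 / 19) ^+ n :> R.
    elim: n => [|n IH]; first by rewrite mul0r expr0 addr0.
    have : 0 <= n%:R / 19 :> R by rewrite divr_ge0.
    rewrite exprS -(natr1 n) mulrDl; lra.
  lra.
have sq : (n%:R / 19) ^+ 2 <= (10 / 9) ^+ n :> R.
  apply: (@le_trans _ _ (((20 / 19) ^+ n) ^+ 2)).
    by rewrite lerXn2r // nnegrE ?divr_ge0 ?exprn_ge0.
  rewrite -exprM mulnC exprM; apply: lerXn2r; rewrite ?nnegrE; lra.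
have -> : n%:R ^+ 2 * (9 / 10) ^+ n = 361 * ((n%:R / 19) ^+ 2 * (9 / 10) ^+ n) :> R.
  by field.
have : (10 / 9) ^+ n * (9 / 10) ^+ n = 1 :> R.
  by rewrite -exprMn (_ : 10 / 9 * (9 / 10) = 1) ?expr1n //; field.
have p0 : 0 <= (9 / 10) ^+ n :> R by rewrite exprn_ge0.
have := ler_wpM2r p0 sq; lra.
Qed.

Lemma expR_le_9_8 (x : R) : x <= 1 / 9 -> expR x <= 9 / 8.
Proof.
move=> x9; have := expR_ge1Dx (- x); rewrite expRN => H.
have e0 := expR_gt0 x; have := ler_wpM2r (ltW e0) H.
rewrite mulVf ?gt_eqF // => H'.
have : (1 - 1 / 9) * expR x <= (1 + - x) * expR x by rewrite ler_pM2r //; lra.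
lra.
Qed.

Lemma expRN_le_inv_sqr (t : R) : 0 < t -> expR (- t) <= 2 / t ^+ 2.
Proof.
move=> t0; rewrite expRN -[leRHS]invf_div lef_pV2 ?posrE ?expR_gt0 ?divr_gt0 ?exprn_gt0 //.
by have := expR_ge1Dxn 1 (ltW t0); rewrite (_ : 2`! = 2)%N //; lra.
Qed.

Lemma sum_pow2 n : \sum_(j <- iota 0 n) 2 ^+ j = 2 ^+ n - 1 :> R.
Proof.
elim: n => [|n IH]; first by rewrite big_nil expr0 subrr.
by rewrite -addn1 iotaD big_cat /= add0n big_seq1 IH addn1 exprS; lra.
Qed.

End Numerics.

(** * Tails of smooth sums and polynomials with rare divisors *)

Section TailSums.
Variables (R : realType) (F : finFieldType).
Implicit Types (A B P Q m b d : {poly F}) (n k y w D : nat).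
Local Notation mi := (monic_irreducible F).
Local Notation nm := (@pnorm R F).

(** Rankin's trick: on [degp b >= k] the factor [expR (theta * (degp b - k))] is at least 1 and may
    be inserted, after which the sum extends to all smooth polynomials. *)
Lemma smooth_tail_le (g : {poly F} -> R) (C0 A1 theta c : R) (p : pred {poly F})
    (w k n : nat) :
  (forall m, m \is monic -> 0 <= g m) -> multiplicative_on_monics g ->
  (forall m, m \is monic -> g m <= C0 * (10 / 9) ^+ degp m) ->
  (forall P, mi P -> g P <= A1) ->
  0 <= theta -> theta <= 1 / 9 -> theta * w%:R <= c ->
  (forall b, b \is monic -> p b -> smooth w b && (k <= degp b)%N) ->
  \sum_(b <- polys F n | (b \is monic) && p b) g b / nm b <=
  expR (- (theta * k%:R)) * expR (25 * C0 + 2 * `|A1| * c * expR c) *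
  expR (\sum_(P <- primes_le F w) g P / nm P).
Proof.
move=> g0 gM gC gA th0 th9 thc pP; rewrite -mulrA.
have := smooth_sum_rankin g0 gM gC n th0 (expR_le_9_8 th9) gA thc.
move/(ler_wpM2l (expR_ge0 (- (theta * k%:R)))); apply: le_trans.
rewrite mulr_sumr.
apply: (@le_trans _ _ (\sum_(b <- polys F n | (b \is monic) && p b)
  expR (- (theta * k%:R)) * (g b * expR (theta * (degp b)%:R) / nm b))).
  apply: ler_sum => b /andP[mb pb]; have /andP[_ kb] := pP b mb pb.
  rewrite mulrA mulrCA -expRD ler_pM2r ?invr_gt0 ?pnorm_gt0 //.
  rewrite ler_peMr ?g0 // -[X in X <= _]expR0 ler_expR addrC -mulrBr.
  by rewrite mulr_ge0 // subr_ge0 ler_nat.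
apply: sum_predW => b /andP[mb].
  by rewrite mulr_ge0 ?expR_ge0 ?divr_ge0 ?mulr_ge0 ?expR_ge0 ?g0 // ltW ?pnorm_gt0.
by move=> pb; rewrite mb; have /andP[] := pP b mb pb.
Qed.

Variables (N h : nat) (A : {poly F}).
Local Notation inI := (in_interval N h A).

(** A union bound over [P]: the offending power has degree at most [2 * y <= h.+1], so its multiples
    are counted exactly. *)
Lemma sum_large_power_le y : (0 < y)%N -> (2 * y <= h.+1)%N ->
  \sum_(m <- polys F N.+1 | inI m && has_large_power y m) 1 <=
  #|F|%:R ^+ h.+1 * (2 * y%:R * (3 / 4) ^+ y) :> R.
Proof.
move=> y0 yh; pose phi v : R := (#|F|%:R ^+ (v * (y %/ v)))^-1.
have q0 := cardF_gt0 R F.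
apply: (@le_trans _ _ (#|F|%:R ^+ h.+1 * \sum_(P <- primes_le F y) phi (degp P) / nm P)).
  rewrite mulr_sumr.
  apply: (@le_trans _ _ (\sum_(P <- primes_le F y)
     \sum_(m <- polys F N.+1 | inI m && (P ^+ (y %/ degp P).+1 %| m)) 1)).
    apply: (sum_cover2 (h := fun _ m => m)) => //; first exact: polys_uniq.
    move=> m sm /andP[im /asboolP[P [iP dP PXm]]].
    by exists P, m; rewrite im PXm mem_primes_le; split=> //; apply/asboolP.
  rewrite big_seq [leRHS]big_seq; apply: ler_sum => P.
  rewrite mem_primes_le => /asboolP[iP dP]; have mP := mi_monic iP.
  apply: le_trans (sum_interval_multiples R N A (monic_exp _ mP) _) _.
    rewrite degpX // (leq_trans _ yh) // mulSn mul2n -addnn leq_add //.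
    exact: leq_trunc_div.
  by rewrite pnormX // [pnorm R P ^+ _]exprS invfM /phi /pnorm -exprM [_^-1 * _]mulrC.
rewrite ler_pM2l ?exprn_gt0 //; apply: le_trans (sum_primes_le _ _ _) _.
  by move=> v; rewrite invr_ge0 exprn_ge0 // ltW.
apply: (@le_trans _ _ (\sum_(v <- iota 1 y) 2 * (3 / 4) ^+ y)); last first.
  rewrite big_const_seq iter_addr_0 count_predT size_iota -[X in X <= _]mulr_natr.
  by rewrite le_eqVlt; apply/orP; left; apply/eqP; ring.
rewrite big_seq [leRHS]big_seq; apply: ler_sum => v.
rewrite mem_iota add1n ltnS => /andP[v0 vy]; apply: ler_pM; rewrite ?divr_ge0 //.
- by rewrite invr_ge0 exprn_ge0 // ltW.
- by rewrite ler_pdivrMr ?ltr0n // ler_peMr // ler1n.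
(* The largest multiple of [v] below or equal to [y] is at least y/2, and 1/q <= 1/2 <= (3/4)^2. *)
pose k := (v * (y %/ v))%N.
have ky : (y <= 2 * k)%N.
  have h1 := divn_eq y v; have h2 := ltn_pmod y v0.
  have h3 : (0 < y %/ v)%N by rewrite divn_gt0.
  have h4 : (v <= k)%N by rewrite /k leq_pmulr.
  by move: h1; rewrite mulnC -/k; lia.
apply: (@le_trans _ _ ((3 / 4) ^+ (2 * k))); last first.
  apply: ler_wiXn2l => //; lra.
rewrite /phi -/k exprM -exprVn; apply: lerXn2r; rewrite ?nnegrE ?invr_ge0 ?(ltW q0) //.
have q2 : 2 <= #|F|%:R :> R by rewrite ler_nat card_field_gt1.
by rewrite -[_^-1]mul1r ler_pdivrMr //; lra.
Qed.

(** Rankin's bound for [g = 1] and theta = 1/9, the sum over primes being at most [2 * w]. It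
    depends on [w] alone, not on the field or on [y]. *)
Definition small_smooth_const w : R :=
  expR (25 + 2 * (w%:R / 9) * expR (w%:R / 9)) * expR (2 * w%:R).

(** For fixed [w], smooth divisors of degree at least [2 * y] are exponentially rare: Rankin's trick
    saves exp(-2y/9), and exp(-1/9) <= 9/10. *)
Lemma sum_smooth_divisor_le y w : (h < N)%N -> (3 * y <= h.+1)%N ->
  \sum_(m <- polys F N.+1 | inI m && `[< exists b, [/\ b \is monic, b %| m,
      smooth w b & (2 * y <= degp b <= 3 * y)%N] >]) 1 <=
  #|F|%:R ^+ h.+1 * ((81 / 100) ^+ y * small_smooth_const w).
Proof.
move=> hN yh; pose p b := smooth w b && (2 * y <= degp b <= 3 * y)%N.
have q0 := cardF_gt0 R F.
apply: (@le_trans _ _ (#|F|%:R ^+ h.+1 *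
   \sum_(b <- polys F N.+1 | (b \is monic) && p b) 1 / nm b)).
  rewrite mulr_sumr.
  apply: (@le_trans _ _ (\sum_(b <- polys F N.+1 | (b \is monic) && p b)
     \sum_(m <- polys F N.+1 | inI m && (b %| m)) 1)).
    apply: (sum_cover2 (h := fun _ m => m)) => //; first exact: polys_uniq.
    move=> m sm /andP[im /asboolP[b [mb bm sb db]]].
    exists b, m; rewrite im bm mb /p sb db; split=> //.
    by rewrite mem_polys (monic_size mb) ltnS; lia.
  apply: ler_sum => b /andP[mb /andP[_ /andP[_ db]]].
  rewrite mul1r; apply: sum_interval_multiples => //; exact: leq_trans db yh.
rewrite ler_pM2l ?exprn_gt0 //.
have H := @smooth_tail_le (fun _ => 1) 1 1 (1 / 9) (w%:R / 9) p w (2 * y) N.+1.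
apply: le_trans (H _ _ _ _ _ _ _ _) _ => //.
- by split=> // *; rewrite mulr1.
- by move=> m mm; rewrite mul1r exprn_ege1 //; lra.
- by rewrite mul1r mulrC.
- by move=> b mb /andP[-> /andP[-> _]].
rewrite /small_smooth_const normr1 !mulr1 -[X in X <= _]mulrA.
apply: ler_pM; rewrite ?mulr_ge0 ?expR_ge0 //.
  rewrite (_ : - (1 / 9 * (2 * y)%:R) = (- (2 / 9)) * y%:R); last by rewrite natrM; field.
  rewrite expRM_natr; apply: lerXn2r; rewrite ?nnegrE ?expR_ge0 //.
  have := expR_ge1Dx (1 / 9 : R) ; rewrite (_ : - (2 / 9) = - (1 / 9) + - (1 / 9)); last by field.
  rewrite expRD expRN => e1.
  have e2 : (expR (1 / 9))^-1 <= 9 / 10 :> R.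
    by rewrite -[_^-1]mul1r ler_pdivrMr ?expR_gt0 //; lra.
  have e3 : 0 <= (expR (1 / 9))^-1 :> R by rewrite invr_ge0 expR_ge0.
  by have := ler_pM e3 e3 e2 e2; lra.
rewrite ler_pM2l ?expR_gt0 // ler_expR.
have S := @sum_primes_le R F (fun=> 1) w; apply: le_trans (S _) _ => //.
apply: (@le_trans _ _ (\sum_(n <- iota 1 w) 2)).
  rewrite big_seq [leRHS]big_seq; apply: ler_sum => n.
  rewrite mem_iota mulr1 => /andP[n0 _].
  by rewrite ler_pdivrMr ?ltr0n // ler_peMr // ler1n.
by rewrite big_const_seq iter_addr_0 count_predT size_iota -[X in X <= _]mulr_natr.
Qed.

End TailSums.

(** * The four classes *)

Section Assembly.
Variables (R : realType) (F : finFieldType) (N h : nat) (A : {poly F}).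
Implicit Types (B P Q m b d : {poly F}) (n k y w D : nat).
Local Notation mi := (monic_irreducible F).
Local Notation nm := (@pnorm R F).
Local Notation inI := (in_interval N h A).
Variables (g : {poly F} -> R) (a C0 : R) (M y j0 : nat).
Hypothesis g_ge0 : forall m, m \is monic -> 0 <= g m.
Hypothesis g_mul : multiplicative_on_monics g.
Hypothesis a_ge1 : 1 <= a.
Hypothesis g_pow : forall P l, mi P -> (0 < l)%N -> g (P ^+ l) <= a ^+ l.
Hypothesis g_le : forall m, m \is monic -> g m <= C0 * (10 / 9) ^+ degp m.
Hypothesis y_gt0 : (0 < y)%N.
Hypothesis y_le : (8 * y <= h)%N.
Hypothesis h_lt : (h < N)%N.
Hypothesis N_le : (N <= M * y)%N.

(* Rankin's exponent for 2^(j+1)-smooth polynomials is [rate / 2 ^+ j.+1].  The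
   gain expR (- rate * y / 2 ^+ j) then beats the bound
   a ^+ (N / 2 ^ j) <= expR (M * a * y / 2 ^+ j) on the rough part. *)
Let rate : R := M%:R * a + 1.
Hypothesis j0_large : 9 * rate <= 2 ^+ j0.

Let mass := expR (\sum_(P <- primes_le F N) g P / nm P).
Let X : R := #|F|%:R ^+ h.+1.

Let a_ge0 : 0 <= a. Proof. exact: le_trans a_ge1. Qed.
Let rate_ge1 : 1 <= rate. Proof. by rewrite /rate lerDr mulr_ge0. Qed.
Let rate_ge0 : 0 <= rate. Proof. exact: le_trans rate_ge1. Qed.
Let gP_le P : mi P -> g P <= a.
Proof. by move=> iP; rewrite -[P]expr1 -[a]expr1 g_pow. Qed.
Let X_gt0 : 0 < X. Proof. by rewrite exprn_gt0 // cardF_gt0. Qed.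

Lemma primes_mass_ge0 w : 0 <= \sum_(P <- primes_le F w) g P / nm P.
Proof.
rewrite big_seq; apply: sumr_ge0 => P; rewrite mem_primes_le => /asboolP[iP _].
by rewrite divr_ge0 ?g_ge0 ?(mi_monic iP) // ltW ?pnorm_gt0.
Qed.

Lemma mass_ge1 : 1 <= mass.
Proof. by rewrite /mass -[X in X <= _]expR0 ler_expR primes_mass_ge0. Qed.

Lemma primes_mass_mono w : (w <= N)%N ->
  expR (\sum_(P <- primes_le F w) g P / nm P) <= mass.
Proof.
move=> wN; rewrite /mass ler_expR big_seq [leRHS]big_seq.
apply: (sum_cover (h := id)); first exact: primes_le_uniq.
  move=> P; rewrite mem_primes_le => /asboolP[iP _].
  by rewrite divr_ge0 ?g_ge0 ?(mi_monic iP) // ltW ?pnorm_gt0.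
move=> P _; rewrite mem_primes_le => /asboolP[iP dP].
have PN : P \in primes_le F N.
  by rewrite mem_primes_le; apply/asboolP; split=> //; apply: leq_trans dP wN.
by exists P; split.
Qed.

(** The dyadic range 2^j <= w < 2^(j+1) of the threshold. *)
Definition medium_class j m := `[< exists b d,
  [/\ b \is monic, d \is monic, m = b * d & coprimep b d] /\
  (smooth (2 ^ j.+1) b && (2 * y <= degp b <= 3 * y)%N) /\ rough (2 ^ j).-1 d >].

(** With t = y/2^j, the Rankin gain times the bound for the rough part is at most exp(-t) <= 2/t^2,
    and the sieve supplies 1/2^j. The product 2 * 2^j/y^2 sums over 2^j <= y to O(1/y). *)
Lemma sum_medium_class_le j : (j0 <= j)%N -> (2 ^ j <= y)%N ->
  \sum_(m <- polys F N.+1 | inI m && medium_class j m) g m <=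
  X * (2 / y%:R ^+ 2 * 2 ^+ j) * expR (25 * C0 + 2 * a * rate * expR rate) * mass.
Proof.
move=> jj0 jy.
have p2 : (0 < 2 ^ j)%N by rewrite expn_gt0.
have p2R : 0 < 2 ^+ j :> R by rewrite exprn_gt0.
have yR : 0 < y%:R :> R by rewrite ltr0n.
pose p b := smooth (2 ^ j.+1) b && (2 * y <= degp b <= 3 * y)%N.
have pD b : b \is monic -> p b -> (degp b + 2 * (2 ^ j).-1 <= h.+1)%N.
  by move=> _ /andP[_ /andP[_ db]]; clear -jy db y_le p2; lia.
apply: le_trans (sum_smooth_rough_le N A g_ge0 g_mul a_ge1 g_pow pD) _.
rewrite -[leLHS]mulrA -[leRHS]mulrA -[X * _ * (_ * _)]mulrA ler_pM2l // prednK // natrX.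
pose theta : R := rate / 2 ^+ j.+1.
have th0 : 0 <= theta by rewrite divr_ge0 ?exprn_ge0.
(* This is where the lower bound on [2 ^+ j0] enters: the Euler product estimate needs
   [expR theta <= 9 / 8]. *)
have th9 : theta <= 1 / 9.
  rewrite ler_pdivrMr ?exprn_gt0 // mulrC mulrA mulr1 ler_pdivlMr // mulrC.
  apply: le_trans j0_large _; apply: ler_weXn2l; rewrite ?ler1n //.
  exact: leq_trans jj0 (leqnSn j).
have thu : theta * (2 ^ j.+1)%:R <= rate by rewrite natrX divfK // expf_neq0.
have tail := @smooth_tail_le R F g C0 a theta rate p (2 ^ j.+1) (2 * y) N.+1
  g_ge0 g_mul g_le gP_le th0 th9 thu.
rewrite (ger0_norm a_ge0) in tail.
apply: le_trans (ler_wpM2l _ (tail _)) _.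
- by rewrite divr_ge0 ?exprn_ge0.
- by move=> b mb /andP[-> /andP[-> _]].
have uN : (2 ^ j.+1 <= N)%N by rewrite expnS; clear -jy y_le h_lt; lia.
have := primes_mass_mono uN.
set E' := expR _; set K1 := expR (_ + _) => E'le.
rewrite -(mulrA (expR _)) (mulrA (a ^+ _ / _)).
apply: ler_pM; rewrite ?mulr_ge0 ?invr_ge0 ?exprn_ge0 ?expR_ge0 //; last first.
  by rewrite ler_pM2l ?expR_gt0.
have aexp : a ^+ (N %/ 2 ^ j) <= expR (a * (M%:R * y%:R / 2 ^+ j)).
  apply: (@le_trans _ _ (expR a ^+ (N %/ 2 ^ j))).
    apply: lerXn2r; rewrite ?nnegrE ?expR_ge0 //.
    by apply: le_trans (expR_ge1Dx a); rewrite lerDr.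
  rewrite -expRM_natr ler_expR ler_wpM2l // ler_pdivlMr // -natrX -!natrM ler_nat.
  exact: leq_trans (leq_trunc_div _ _) N_le.
(* Here [rate = M * a + 1]: the part [M * a] cancels the rough factor exactly, and the 1 leaves the
   decay. *)
have e2 : expR (a * (M%:R * y%:R / 2 ^+ j)) * expR (- (theta * (2 * y)%:R)) =
    expR (- (y%:R / 2 ^+ j)).
  rewrite -expRD; congr expR; rewrite /theta /rate natrM exprS.
  by field; rewrite gt_eqF.
have yj : 0 < y%:R / 2 ^+ j :> R by rewrite divr_gt0.
have e3 := expRN_le_inv_sqr yj.
apply: (@le_trans _ _ (expR (- (y%:R / 2 ^+ j)) / 2 ^+ j)).
  rewrite -e2 mulrAC ler_pM2r ?invr_gt0 //.
  by apply: ler_wpM2r; rewrite ?expR_ge0.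
rewrite ler_pdivrMr //; apply: le_trans e3 _.
rewrite le_eqVlt; apply/orP; left; apply/eqP; field.
by rewrite !gt_eqF.
Qed.

Definition medium m := `[< exists b d w,
  [/\ b \is monic, d \is monic, m = b * d & coprimep b d] /\
  [/\ (2 ^ j0 <= w <= y)%N, smooth w b, rough w.-1 d &
      (2 * y <= degp b <= 3 * y)%N] >].

Lemma sum_medium_le :
  \sum_(m <- polys F N.+1 | inI m && medium m) g m <=
  X * (4 / y%:R) * expR (25 * C0 + 2 * a * rate * expR rate) * mass.
Proof.
have yR : 0 < y%:R :> R by rewrite ltr0n.
pose L := trunc_log 2 y; have Ly : (2 ^ L <= y)%N by rewrite trunc_logP.
apply: (@le_trans _ _ (\sum_(j <- iota 0 L.+1 | (j0 <= j)%N)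
   \sum_(m <- polys F N.+1 | inI m && medium_class j m) g m)).
  apply: (sum_cover2 (h := fun _ m => m)); first exact: polys_uniq.
    by move=> j m _ /andP[/and3P[mm _ _] _]; apply: g_ge0.
  move=> m sm /andP[im /asboolP[b [d [w [fact [/andP[w1 w2] sb rd db]]]]]].
  have w0 : (0 < w)%N by apply: leq_trans w1; rewrite expn_gt0.
  have /andP[t1 t2] := trunc_log_bounds (isT : (1 < 2)%N) w0.
  (* The dyadic index of [w]; it is at least [j0] because [2 ^ j0 <= w]. *)
  exists (trunc_log 2 w), m; split=> //.
  - by rewrite mem_iota /= add0n ltnS leq_trunc_log.
  - rewrite trunc_log_max //= im; apply/asboolP; exists b, d; split=> //; split.
      by rewrite db andbT; apply: smoothW sb; apply: ltnW.
    by apply: roughW rd; rewrite -!subn1 leq_sub2r.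
apply: (@le_trans _ _ (\sum_(j <- iota 0 L.+1)
   X * (2 / y%:R ^+ 2 * 2 ^+ j) * expR (25 * C0 + 2 * a * rate * expR rate) * mass)).
  rewrite big_mkcond big_seq [leRHS]big_seq; apply: ler_sum => j.
  rewrite mem_iota /= add0n ltnS => jL; case: ifP => [jj0|_].
    by apply: sum_medium_class_le => //; apply: leq_trans Ly; rewrite leq_exp2l.
  by rewrite !mulr_ge0 ?invr_ge0 ?exprn_ge0 ?expR_ge0 // ltW.
rewrite -!mulr_suml -mulr_sumr -mulr_sumr sum_pow2.
rewrite !ler_pM2r ?expR_gt0 // ler_pM2l //.
have : 2 ^+ L.+1 <= 2 * y%:R :> R by rewrite exprS -natrX ler_pM2l // ler_nat.
move=> H; rewrite (_ : 4 / y%:R = 2 / y%:R ^+ 2 * (2 * y%:R)); last first.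
  by field; rewrite gt_eqF.
apply: ler_wpM2l; first by rewrite divr_ge0 ?exprn_ge0.
lra.
Qed.

Definition large_rough m := `[< exists b d,
  [/\ b \is monic, d \is monic, m = b * d & coprimep b d] /\
  (degp b <= 3 * y)%N /\ rough y d >].

(** The sieve at level [y] fits because 3y + 2y <= h + 1, and N <= M y keeps the rough part below
    [a ^+ M]. The sum over [b] needs no decay and is bounded by the Euler product with theta = 0. *)
Lemma sum_large_rough_le :
  \sum_(m <- polys F N.+1 | inI m && large_rough m) g m <=
  X * (a ^+ M / y%:R) * expR (25 * C0) * mass.
Proof.
have yR : 0 < y%:R :> R by rewrite ltr0n.
have pD b : b \is monic -> (degp b <= 3 * y)%N -> (degp b + 2 * y <= h.+1)%N.
  by move=> _ db; clear -db y_le; lia.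
apply: le_trans (sum_smooth_rough_le (p := fun b => (degp b <= 3 * y)%N)
  N A g_ge0 g_mul a_ge1 g_pow pD) _.
rewrite -!mulrA ler_pM2l // mulrA.
have p_smooth b : b \is monic -> (degp b <= 3 * y)%N -> smooth N b && (0 <= degp b)%N.
  move=> mb db; rewrite andbT; apply/asboolP => P iP dP.
  by apply: leq_trans (monic_dvd_degp mb dP) _; clear -db y_le h_lt; lia.
have th9 : 0 <= 1 / 9 :> R by rewrite divr_ge0.
have thN : 0 * N%:R <= 0 :> R by rewrite mul0r.
have tail := smooth_tail_le N.+1 g_ge0 g_mul g_le gP_le (lexx _) th9 thN p_smooth.
rewrite mul0r oppr0 expR0 mul1r mulr0 mul0r addr0 in tail.
rewrite [leRHS]mulrA; apply: ler_pM.
- by rewrite divr_ge0 ?exprn_ge0.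
- apply: sumr_ge0 => b /andP[mb _].
  by rewrite divr_ge0 ?g_ge0 // ltW ?pnorm_gt0.
- apply: ler_pM; rewrite ?exprn_ge0 ?invr_ge0 //.
    apply: ler_weXn2l => //; rewrite -ltnS ltn_divLR //.
    by apply: leq_ltn_trans N_le _; rewrite mulSn mulnS; clear; lia.
  by rewrite lef_pV2 ?posrE ?ltr0n // ler_nat.
exact: tail.
Qed.

Variable C1 : R.
Hypothesis C1_ge0 : 0 <= C1.
Hypothesis g_interval : forall m, m \is monic -> degp m = N -> g m <= C1 * (10 / 9) ^+ y.

Definition small_smooth m := `[< exists b, [/\ b \is monic, b %| m,
      smooth (2 ^ j0) b & (2 * y <= degp b <= 3 * y)%N] >].

(** The pointwise bound (10/9)^y meets a density rho^y with 10/9 * 81/100 = 9/10, and the remaining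
    exponential decay absorbs y^2. *)
Lemma sum_sparse_le (p : pred {poly F}) (rho K : R) : 0 <= K -> 0 <= rho -> rho <= 81 / 100 ->
  \sum_(m <- polys F N.+1 | inI m && p m) 1 <= X * (K * y%:R * rho ^+ y) ->
  \sum_(m <- polys F N.+1 | inI m && p m) g m <= X * (361 * C1 * K / y%:R).
Proof.
move=> K0 r0 r1 H; have yR : 0 < y%:R :> R by rewrite ltr0n.
have c0 : 0 <= C1 * (10 / 9) ^+ y by rewrite mulr_ge0 ?exprn_ge0 ?divr_ge0.
apply: (@le_trans _ _ (C1 * (10 / 9) ^+ y * \sum_(m <- polys F N.+1 | inI m && p m) 1)).
  rewrite mulr_sumr; apply: ler_sum => m /andP[/and3P[mm /eqP dm _] _].
  by rewrite mulr1 g_interval.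
apply: le_trans (ler_wpM2l c0 H) _; rewrite mulrCA ler_pM2l // ler_pdivlMr //.
have -> : C1 * (10 / 9) ^+ y * (K * y%:R * rho ^+ y) * y%:R =
    C1 * K * (y%:R ^+ 2 * (10 / 9 * rho) ^+ y) by rewrite [(_ * rho) ^+ _]exprMn; set u := (_ / _) ^+ _; set v := rho ^+ _; ring.
have -> : 361 * C1 * K = C1 * K * 361 by ring.
apply: ler_wpM2l; first exact: mulr_ge0.
apply: le_trans (sqr_geom_le R y); apply: ler_wpM2l; first by rewrite exprn_ge0.
by apply: lerXn2r; rewrite ?nnegrE; lra.
Qed.

Lemma sum_interval_le :
  \sum_(m <- polys F N.+1 | inI m) g m <=
  (722 * C1 + 361 * C1 * small_smooth_const R (2 ^ j0) + a ^+ M * expR (25 * C0) +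
   4 * expR (25 * C0 + 2 * a * rate * expR rate)) * (X / y%:R * mass).
Proof.
have yR : 0 < y%:R :> R by rewrite ltr0n.
have yR1 : 1 <= y%:R :> R by rewrite ler1n.
have gI m : inI m -> 0 <= g m by case/and3P=> mm _ _; apply: g_ge0.
apply: (@le_trans _ _ (
  \sum_(m <- polys F N.+1 | inI m && has_large_power y m) g m +
  (\sum_(m <- polys F N.+1 | inI m && small_smooth m) g m +
  (\sum_(m <- polys F N.+1 | inI m && large_rough m) g m +
   \sum_(m <- polys F N.+1 | inI m && medium m) g m)))).
  have mkcond p : \sum_(m <- polys F N.+1 | inI m && p m) g m =
      \sum_(m <- polys F N.+1 | inI m) if p m then g m else 0 by rewrite -big_mkcondr.
  rewrite !mkcond -!big_split /=; apply: ler_sum => m im.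
  have gm := gI m im; have [mm /eqP dm _] := and3P im.
  have [bad|nbad] := boolP (has_large_power y m).
    by rewrite lerDl !addr_ge0 //; case: ifP.
  rewrite add0r; have dm3 : (3 * y < degp m)%N by rewrite dm; clear -y_le h_lt; lia.
  (* The threshold selects the class: [w > y], [w < 2 ^ j0], or the range between. *)
  have [b [d [w [fact [w0 db sb rd ]]]]] := smooth_rough_factorization mm dm3 nbad.
  case/orP => [yw|/andP[db2 wy]].
    have -> : large_rough m.
      apply/asboolP; exists b, d; do 2!split=> //; apply: roughW rd; clear -yw; lia.
    by rewrite addrCA lerDl !addr_ge0 //; case: ifP.
  have [w1|w1] := ltnP w (2 ^ j0).
    have -> : small_smooth m.
      case: fact => mb md em _; apply/asboolP; exists b; split=> //.
      - by rewrite em dvdp_mulIl.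
      - by apply: smoothW sb; apply: ltnW.
      by rewrite db2 db.
    by rewrite lerDl !addr_ge0 //; case: ifP.
  have -> : medium m.
    by apply/asboolP; exists b, d, w; split=> //; split; rewrite ?w1 ?wy ?db2 ?db.
  by rewrite addrA lerDr !addr_ge0 //; case: ifP.
(* The bounds for the two sparse classes lack the factor [mass], which may be inserted since it is
   at least 1. *)
have m1 := mass_ge1.
have Z0 : 0 <= X / y%:R by rewrite divr_ge0 ?ltW.
have ss0 : 0 <= small_smooth_const R (2 ^ j0) by rewrite mulr_ge0 ?expR_ge0.
have b1 : \sum_(m <- polys F N.+1 | inI m && has_large_power y m) g m <=
    722 * C1 * (X / y%:R * mass).
  apply: (@le_trans _ _ (X * (361 * C1 * 2 / y%:R))).
    apply: (sum_sparse_le (rho := 3 / 4)) => //; try lra.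
    by apply: sum_large_power_le => //; clear -y_le; lia.
  rewrite (_ : X * _ = 722 * C1 * (X / y%:R)); last by ring.
  rewrite [leRHS]mulrA; apply: ler_peMr (mulr_ge0 _ Z0) m1.
  exact: mulr_ge0 (ler0n R 722) C1_ge0.
have b2 : \sum_(m <- polys F N.+1 | inI m && small_smooth m) g m <=
    361 * C1 * small_smooth_const R (2 ^ j0) * (X / y%:R * mass).
  apply: (@le_trans _ _ (X * (361 * C1 * small_smooth_const R (2 ^ j0) / y%:R))).
    apply: (sum_sparse_le (rho := 81 / 100)) => //; try lra.
    apply: le_trans (sum_smooth_divisor_le R A _ h_lt _) _; first by clear -y_le; lia.
    rewrite ler_pM2l // mulrC; apply: ler_wpM2r; first by rewrite exprn_ge0 ?divr_ge0.
    by rewrite ler_peMr.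
  rewrite (_ : X * _ = 361 * C1 * small_smooth_const R (2 ^ j0) * (X / y%:R)); last by ring.
  rewrite [leRHS]mulrA; apply: ler_peMr (mulr_ge0 (mulr_ge0 _ ss0) Z0) m1.
  exact: mulr_ge0 (ler0n R 361) C1_ge0.
have b3 := sum_large_rough_le; have b4 := sum_medium_le.
rewrite (_ : X * _ * _ * _ = a ^+ M * expR (25 * C0) * (X / y%:R * mass)) in b3; last by ring.
rewrite (_ : X * _ * _ * _ = 4 * expR (25 * C0 + 2 * a * rate * expR rate) * (X / y%:R * mass)) in b4; last by ring.
have := lerD b1 (lerD b2 (lerD b3 b4)).
by rewrite -!mulrDl !addrA.
Qed.

End Assembly.

(** * Passage to the original sums and choice of constants *)

(** Holds because (10/9)^8 > 2. *)
Lemma powR2_le (R : realType) (n : nat) : 2 `^ (1 / 8 * n%:R) <= (10 / 9) ^+ n :> R.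
Proof.
rewrite powRrM powR_mulrn ?powR_ge0 //.
apply: lerXn2r; rewrite ?nnegrE ?powR_ge0 ?divr_ge0 //.
rewrite -(@ler_pXn2r _ 8) // ?nnegrE ?powR_ge0 ?divr_ge0 //.
rewrite -powR_mulrn ?powR_ge0 // -powRrM (_ : 1 / 8 * 8%:R = 1); last by field.
by rewrite powRr1 //; lra.
Qed.

Lemma short_interval_sumE (R : realType) (F : finFieldType) (N h : nat)
    (A : {poly F}) (g : {poly F} -> R) :
  \sum_(m \in short_interval N A h) g m =
  \sum_(m <- polys F N.+1 | in_interval N h A m) g m.
Proof.
have -> : short_interval N A h = [set` [seq m <- polys F N.+1 | in_interval N h A m]].
  apply/seteqP; split=> m /=.
    move=> [[mm dm] sm]; rewrite mem_filter mem_polys (monic_size mm) dm leqnn andbT.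
    by apply/and3P; split=> //; apply/eqP.
  by rewrite mem_filter => /andP[/and3P[mm /eqP dm sm] _].
by rewrite -fsbig_seq ?filter_uniq ?polys_uniq // big_filter.
Qed.

Lemma primes_upto_sumE (R : realType) (F : finFieldType) (N : nat)
    (f : {poly F} -> R) :
  \sum_(P \in primes_upto F N) f P = \sum_(P <- primes_le F N) f P.
Proof.
have -> : primes_upto F N = [set` primes_le F N].
  by apply/seteqP; split=> P /=; rewrite mem_primes_le => /asboolP.
by rewrite -fsbig_seq ?primes_le_uniq.
Qed.

Theorem theorem2p6 (R : realType) (beta : R) (hbeta0 : 0 < beta)
    (hbeta1 : beta < 1 / 2) :
  exists N0 : nat,
  forall (A1 : R) (C : R -> R),
    0 < A1 ->
    (forall eps : R, 0 < eps -> 0 < C eps) ->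
  exists2 K : R, 0 < K &
  forall (Fq : finFieldType) (N : nat) (g : {poly Fq} -> R)
         (A : {poly Fq}) (h : nat),
    (1 <= N)%N ->
    (N0 <= N)%N ->
    (forall F : {poly Fq}, F \is monic -> 0 <= g F) ->
    multiplicative_on_monics g ->
    (forall (P : {poly Fq}) (l : nat), monic_irreducible Fq P -> (1 <= l)%N ->
       g (P ^+ l) <= A1 ^+ l) ->
    (forall (eps : R) (F : {poly Fq}), 0 < eps -> F \is monic ->
       g F <= C eps * 2 `^ (eps * (degp F)%:R)) ->
    monic_of_deg Fq N A ->
    beta * N%:R < h%:R ->
    (h <= N - 1)%N ->
    \sum_(F \in short_interval N A h) g F
      <= K * ((#|Fq|%:R ^+ h.+1) / N%:R *
              expR (\sum_(P \in primes_upto Fq N) (g P / #|Fq|%:R ^+ degp P))).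
Proof.
(* Since [h > beta * N], this gives [16 * N < M * h]; with [h <= 16 * y] it yields [N <= M * y]. *)
set M := Num.bound (16 / beta).
have Mbeta : 16 / beta < M%:R by apply: archi_boundP; rewrite divr_ge0 ?ltW.
have M0 : 0 < M%:R :> R by apply: le_lt_trans Mbeta; rewrite divr_ge0 ?ltW.
have Mb : 16 < M%:R * beta by rewrite -ltr_pdivrMr.
(* For [N >= M], the inequality [16 * N < M * h] forces [h > 16], so [y = h %/ 8] is positive and
   [h <= 16 * y]. *)
exists M => A1 C A1_gt0 C_gt0.
pose a := 1 + A1; have a1 : 1 <= a by rewrite lerDl ltW.
pose rate := M%:R * a + 1.
pose j0 := Num.bound (9 * rate).
have rate0 : 0 <= 9 * rate by rewrite mulr_ge0 // addr_ge0 // mulr_ge0 ?(le_trans _ a1) // ltW.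
have j0_large : 9 * rate <= 2 ^+ j0.
  apply: (le_trans (ltW (archi_boundP rate0))).
  by rewrite -natrX ler_nat ltnW // ltn_expl.
(* Chosen so that [eps * N <= y / 8], whence 2^(eps N) <= (10/9)^y on the interval. *)
pose eps : R := 1 / 8 / M%:R; have eps0 : 0 < eps by rewrite !divr_gt0.
have e8 : 0 < 1 / 8 :> R by rewrite divr_gt0.
pose C0 := C (1 / 8); pose C1 := C eps.
have C1_gt0 : 0 < C1 := C_gt0 _ eps0.
pose K0 := 722 * C1 + 361 * C1 * small_smooth_const R (2 ^ j0) + a ^+ M * expR (25 * C0) +
   4 * expR (25 * C0 + 2 * a * rate * expR rate).
have K0_gt0 : 0 < K0.
  apply: ltr_wpDl; last exact: mulr_gt0 (ltr0Sn R 3) (expR_gt0 _).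
  have a0 : 0 <= a := le_trans ler01 a1.
  apply: addr_ge0; last exact: mulr_ge0 (exprn_ge0 _ a0) (expR_ge0 _).
  apply: addr_ge0; first exact: mulr_ge0 (ler0n R 722) (ltW C1_gt0).
  apply: mulr_ge0 (mulr_ge0 (ler0n R 361) (ltW C1_gt0)) _.
  exact: mulr_ge0 (expR_ge0 _) (expR_ge0 _).
(* The factor [M] converts 1/y into 1/N. Everything in [K0] is fixed by [beta], [A1] and [C] before
   the field is introduced. *)
exists (K0 * M%:R); first exact: mulr_gt0.
move=> Fq N g A h N1 NM g0 gM gP gC [mA dA] bh hN.
have hlt : (h < N)%N by clear -N1 hN; lia.
have N0 : 0 < N%:R :> R by rewrite ltr0n.
pose y := (h %/ 8)%N.
have h16 : (16 * N < M * h)%N.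
  rewrite -(ltr_nat R) !natrM; apply: (@le_lt_trans _ _ (M%:R * beta * N%:R)).
    by rewrite ler_pM2r // ltW.
  by rewrite -mulrA ltr_pM2l.
have h16' : (16 < h)%N.
  rewrite ltnNge; apply/negP => h_le.
  have : (M * h <= M * 16)%N by rewrite leq_mul2l h_le orbT.
  by clear -h16 NM; lia.
have y0 : (0 < y)%N by rewrite divn_gt0 //; apply: leq_trans h16'.
have y8 : (8 * y <= h)%N by rewrite mulnC leq_trunc_div.
have h16y : (h <= 16 * y)%N by rewrite /y; clear -h16'; lia.
have NMy : (N <= M * y)%N.
  have : (M * h <= M * (16 * y))%N by rewrite leq_mul2l h16y orbT.
  by clear -h16; lia.
rewrite short_interval_sumE primes_upto_sumE.
have gpow P l : monic_irreducible Fq P -> (0 < l)%N -> g (P ^+ l) <= a ^+ l.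
  move=> iP l0; apply: le_trans (gP P l iP l0) _.
  by apply: lerXn2r; rewrite ?nnegrE ?addr_ge0 ?lerDr ?ltW.
have gle m : m \is monic -> g m <= C0 * (10 / 9) ^+ degp m.
  move=> mm; apply: le_trans (gC _ _ e8 mm) _.
  by rewrite ler_pM2l ?powR2_le // C_gt0.
have gint m : m \is monic -> degp m = N -> g m <= C1 * (10 / 9) ^+ y.
  move=> mm dm; apply: le_trans (gC _ _ eps0 mm) _; rewrite ler_pM2l // dm.
  apply: le_trans (powR2_le R y); apply: ler_powR; first by rewrite ler1n.
  by rewrite /eps -[leLHS]mulrA ler_pM2l // ler_pdivrMl // -natrM ler_nat.
have main := sum_interval_le A g0 gM a1 gpow gle y0 y8 hlt NMy j0_large (ltW C1_gt0) gint.
have Xle : #|Fq|%:R ^+ h.+1 / y%:R <= M%:R * (#|Fq|%:R ^+ h.+1 / N%:R) :> R.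
  rewrite mulrCA ler_pM2l ?exprn_gt0 ?cardF_gt0 //.
  by rewrite ler_pdivlMr // mulrC ler_pdivrMr ?ltr0n // -natrM ler_nat.
have := ler_wpM2r (expR_ge0 (\sum_(P <- primes_le Fq N) g P / pnorm R P)) Xle.
move/(ler_wpM2l (ltW K0_gt0)) => H; apply: le_trans main (le_trans H _).
by rewrite -(mulrA M%:R) mulrA.
Qed.
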